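(* Let Standing Assumption 1 and Assumption 3 hold and let $\sigma\in C^1(\mathbb R)$. For each $\varepsilon>0$ let $\theta_\varepsilon$ be an $\varepsilon$-approximating network (of some architecture). Then there exist $\varepsilon_1>0$ and $c>0$ such that for all $0<\varepsilon<\varepsilon_1$ and all $y_0\in Y_0$ the closed-loop system $$\dot y=f(y)+BF^\sigma_{\theta_\varepsilon}(y),\qquad y(0)=y_0,$$ has a unique solution $\mathbf y_\varepsilon(y_0)\in\mathcal Y_{ad}$, which satisfies $\|y^*(y_0)-\mathbf y_\varepsilon(y_0)\|_{W_\infty}\le c\varepsilon$ and $\|\mathbf y_\varepsilon(y_0)\|_{W_\infty}\le\frac32M|y_0|$. Moreover $\mathbf y_\varepsilon\in L^\infty_\mu(Y_0;W_\infty)$ with $\|\mathbf y_\varepsilon\|_{L^\infty_\mu(Y_0;W_\infty)}\le\frac32M_{Y_0}$.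
   Context: $I=[0,\infty)$, $W_\infty=\{y\in L^2(I;\mathbb R^n):\dot y\in L^2(I;\mathbb R^n)\}$ with norm $\|y\|_{W_\infty}=(\|y\|_{L^2}^2+\|\dot y\|_{L^2}^2)^{1/2}$; $C_\imath>0$ is a constant with $\sup_{t\ge0}|y(t)|\le C_\imath\|y\|_{W_\infty}$. Given $f:\mathbb R^n\to\mathbb R^n$, $B\in\mathbb R^{n\times m}$, positive semidefinite $Q$, $\beta>0$, problem $(P^{y_0}_\beta)$ is: minimize $\frac12\int_0^\infty(|Qy|^2+\beta|u|^2)dt$ over $(y,u)\in W_\infty\times L^2(I;\mathbb R^m)$ with $\dot y=f(y)+Bu$, $y(0)=y_0$. Standing Assumption 1: $Y_0\subset\mathbb R^n$ is compact with $0\in Y_0$, and (A.1) $f\in C^1$, $f(0)=0$, $Df$ Lipschitz on compact sets; (A.2) there exist an open neighbourhood $\mathcal N(Y_0)$ of $Y_0$ and $F^*:\mathcal N(Y_0)\to\mathbb R^m$, $F^*(0)=0$, such that for every $y_0\in\mathcal N(Y_0)$ the closed-loop system $\dot y=f(y)+BF^*(y)$, $y(0)=y_0$ has a unique solution $y^*(y_0)\in W_\infty$ and $(y^*(y_0),F^*(y^*(y_0)))$ minimizes $(P^{y_0}_\beta)$; (A.3) $y_0\mapsto y^*(y_0)$ is continuously Fréchet differentiable from $\mathcal N(Y_0)$ to $W_\infty$ and $\|y^*(y_0)\|_{W_\infty}\le M|y_0|$ for some $M>0$ and all $y_0\in\mathcal N(Y_0)$. Set $M_{Y_0}=M\max_{y_0\in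 Y_0}|y_0|$, $\widehat M=C_\imath M_{Y_0}$, $\mathcal Y_{ad}=\{y\in W_\infty:\|y\|_{W_\infty}\le2M_{Y_0}\}$; (A.4) $F^*$ extends to a $C^1$ map on $\bar B_{2\widehat M}(0)$ with Lipschitz derivative there. Assumption 3: there is $C>0$ such that for every $y_0\in\mathcal N(Y_0)$, $\delta y_0\in\mathbb R^n$ and $\delta v\in L^2(I;\mathbb R^n)$ there is a unique $\delta y\in W_\infty$ with $\dot{\delta y}=Df(y^*(y_0))\delta y+B\,DF^*(y^*(y_0))\delta y+\delta v$, $\delta y(0)=\delta y_0$, and $\|\delta y\|_{W_\infty}\le C(\|\delta v\|_{L^2}+|\delta y_0|)$. $(Y_0,\mathcal A,\mu)$ is a complete probability space whose $\sigma$-algebra contains the Borel sets; $L^\infty_\mu(Y_0;W_\infty)$ is the Bochner space of strongly measurable essentially bounded $W_\infty$-valued functions. Networks: $\theta=(W_1,b_1,\dots,W_L,b_L)$ with $W_i\in\mathbb R^{N_i\times N_{i-1}}$, $b_i\in\mathbb R^{N_i}$, $N_0=n$, $N_L=m$; $f_{i,\theta}(x)=\sigma(W_ix+b_i)$ ($\sigma$ componentwise) for $i<L$, $f_{L,\theta}(x)=W_Lx+b_L$, $\Psi_\theta=f_{L,\theta}\circ\dots\circ f_{1,\theta}$, realization $F^\sigma_\theta(x)=\Psi_\theta(x)-\Psi_\theta(0)$. A network $\theta$ is $\varepsilon$-approximating if $|F^*(x)-F^\sigma_\theta(x)|+\|DF^*(x)-DF^\sigma_\theta(x)\|\le\varepsilon$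 for all $|x|\le2\widehat M$. *)

(* Defs.v *)
From HB Require Import structures.
From mathcomp Require Import all_boot all_order all_algebra.
From mathcomp Require Import all_classical all_reals all_analysis.
From mathcomp Require Import ess_sup_inf.
Set Implicit Arguments. Unset Strict Implicit. Unset Printing Implicit Defensive.
Import Order.TTheory GRing.Theory Num.Theory.
Import numFieldNormedType.Exports.
Local Open Scope classical_set_scope.
Local Open Scope ring_scope.

Definition enorm (R : realType) (n : nat) (v : 'cV[R]_n) : R :=
  Num.sqrt (\sum_(i < n) v i 0 ^+ 2).

Definition opnorm (R : realType) (m n : nat) (A : 'M[R]_(m, n)) : R :=
  sup [set enorm (A *m v) | v in [set v : 'cV[R]_n | enorm v <= 1]].

Definition hasDerivWithin (R : realType) (n m : nat) (K : set 'cV[R]_n)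
  (F : 'cV[R]_n -> 'cV[R]_m) (D : 'M[R]_(m, n)) (x : 'cV[R]_n) : Prop :=
  forall e : R, 0 < e -> exists2 d : R, 0 < d &
    forall z, K z -> enorm (z - x) < d ->
      enorm (F z - F x - D *m (z - x)) <= e * enorm (z - x).

Definition hasDeriv (R : realType) (n m : nat)
  (F : 'cV[R]_n -> 'cV[R]_m) (D : 'M[R]_(m, n)) (x : 'cV[R]_n) : Prop :=
  hasDerivWithin setT F D x.

Definition cball0 (R : realType) (n : nat) (r : R) : set 'cV[R]_n :=
  [set x | enorm x <= r].

Definition Itime (R : realType) : set R := `[0%R, +oo[%classic.
Arguments Itime R : clear implicits.

Notation leb R := (@lebesgue_measure R).

Definition L2sqE (R : realType) (n : nat) (y : R -> 'cV[R]_n) : \bar R :=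
  (\int[leb R]_(t in Itime R) ((enorm (y t)) ^+ 2)%:E)%E.

Definition L2fun (R : realType) (n : nat) (y : R -> 'cV[R]_n) : Prop :=
  (forall i : 'I_n, measurable_fun (Itime R) (fun t => y t i 0)) /\
  (L2sqE y < +oo)%E.

Definition L2norm (R : realType) (n : nat) (y : R -> 'cV[R]_n) : R :=
  Num.sqrt (fine (L2sqE y)).

Definition vint (R : realType) (n : nat) (v : R -> 'cV[R]_n) (a b : R) : 'cV[R]_n :=
  \col_(i < n) Rintegral (leb R) `[a, b] (fun s => v s i 0).

(* W_infty: y in L^2(I;R^n) absolutely continuous on I with derivative
   in L^2(I;R^n), i.e. y(t) = y(0) + int_0^t v for some v in L^2 *)
Definition Winf (R : realType) (n : nat) (y : R -> 'cV[R]_n) : Prop :=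
  L2fun y /\ exists2 v : R -> 'cV[R]_n, L2fun v &
    forall t, Itime R t -> y t = y 0 + vint v 0 t.

(* the time derivative (componentwise classical derivative; for y in W_infty
   it exists a.e. on I and is the weak derivative) *)
Definition Wdot (R : realType) (n : nat) (y : R -> 'cV[R]_n) : R -> 'cV[R]_n :=
  fun t => \col_(i < n) derive1 (fun s => y s i 0) t.

Definition Wnorm (R : realType) (n : nat) (y : R -> 'cV[R]_n) : R :=
  Num.sqrt (fine (L2sqE y) + fine (L2sqE (Wdot y))).

Definition eqI (R : realType) (n : nat) (y z : R -> 'cV[R]_n) : Prop :=
  forall t, Itime R t -> y t = z t.

Definition solvesW (R : realType) (n : nat) (g : R -> 'cV[R]_n -> 'cV[R]_n)
  (y0 : 'cV[R]_n) (y : R -> 'cV[R]_n) : Prop :=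
  Winf y /\ y 0 = y0 /\
  {ae leb R, forall t, Itime R t -> Wdot y t = g t (y t)}.

Definition closedLoop (R : realType) (n m : nat) (f : 'cV[R]_n -> 'cV[R]_n)
  (B : 'M[R]_(n, m)) (F : 'cV[R]_n -> 'cV[R]_m) (y0 : 'cV[R]_n)
  (y : R -> 'cV[R]_n) : Prop :=
  solvesW (fun _ x => f x + B *m F x) y0 y.

Definition costJ (R : realType) (n m : nat) (Q : 'M[R]_n) (beta : R)
  (y : R -> 'cV[R]_n) (u : R -> 'cV[R]_m) : \bar R :=
  ((2%:R)^-1%:E * \int[leb R]_(t in Itime R)
      ((enorm (Q *m y t)) ^+ 2 + beta * (enorm (u t)) ^+ 2)%:E)%E.

Definition admissibleP (R : realType) (n m : nat) (f : 'cV[R]_n -> 'cV[R]_n)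
  (B : 'M[R]_(n, m)) (y0 : 'cV[R]_n) (y : R -> 'cV[R]_n) (u : R -> 'cV[R]_m) : Prop :=
  Winf y /\ L2fun u /\ solvesW (fun t x => f x + B *m u t) y0 y.

Definition minimizesP (R : realType) (n m : nat) (f : 'cV[R]_n -> 'cV[R]_n)
  (B : 'M[R]_(n, m)) (Q : 'M[R]_n) (beta : R) (y0 : 'cV[R]_n)
  (y : R -> 'cV[R]_n) (u : R -> 'cV[R]_m) : Prop :=
  admissibleP f B y0 y u /\
  forall y' u', admissibleP f B y0 y' u' -> (costJ Q beta y u <= costJ Q beta y' u')%E.

Definition psd (R : realType) (n : nat) (Q : 'M[R]_n) : Prop :=
  Q^T = Q /\ forall x : 'cV[R]_n, 0 <= (x^T *m Q *m x) 0 0.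

Definition assumptionA1 (R : realType) (n : nat) (f : 'cV[R]_n -> 'cV[R]_n)
  (Df : 'cV[R]_n -> 'M[R]_n) : Prop :=
  (forall x, hasDeriv f (Df x) x) /\
  (forall x e, 0 < e -> exists2 d, 0 < d &
       forall z, enorm (z - x) < d -> opnorm (Df z - Df x) <= e) /\
  f 0 = 0 /\
  (forall K : set 'cV[R]_n, compact K -> exists L : R,
       forall x z, K x -> K z -> opnorm (Df x - Df z) <= L * enorm (x - z)).

Definition C1FrechetW (R : realType) (n : nat) (Nb : set 'cV[R]_n)
  (ystar : 'cV[R]_n -> R -> 'cV[R]_n) : Prop :=
  exists Dy : 'cV[R]_n -> 'cV[R]_n -> R -> 'cV[R]_n,
    (forall y0, Nb y0 -> forall h, Winf (Dy y0 h)) /\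
    (forall y0, Nb y0 -> forall (a : R) h k,
       eqI (Dy y0 (a *: h + k)) (fun t => a *: Dy y0 h t + Dy y0 k t)) /\
    (forall y0, Nb y0 -> forall e, 0 < e -> exists2 d, 0 < d &
       forall h, enorm h < d -> Nb (y0 + h) ->
         Wnorm (fun t => ystar (y0 + h) t - ystar y0 t - Dy y0 h t)
           <= e * enorm h) /\
    (forall y0, Nb y0 -> forall e, 0 < e -> exists2 d, 0 < d &
       forall y1, Nb y1 -> enorm (y1 - y0) < d ->
         forall h, Wnorm (fun t => Dy y1 h t - Dy y0 h t) <= e * enorm h).

Definition MY0 (R : realType) (n : nat) (M : R) (Y0 : set 'cV[R]_n) : R :=
  M * sup [set enorm y | y in Y0].

Definition Yad (R : realType) (n : nat) (M : R) (Y0 : set 'cV[R]_n)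
  (y : R -> 'cV[R]_n) : Prop :=
  Winf y /\ Wnorm y <= 2%:R * MY0 M Y0.

(* net R d m: a network with input width d and output width m;
   NLast W b is the last (affine) layer, NHidden W b th a hidden layer
   x |-> sigma(W x + b) followed by the network th. *)
Inductive net (R : Type) : nat -> nat -> Type :=
| NLast (d m : nat) of 'M[R]_(m, d) & 'cV[R]_m : net R d m
| NHidden (d k m : nat) of 'M[R]_(k, d) & 'cV[R]_k & net R k m : net R d m.

Fixpoint netPsi (R : realType) (sigma : R -> R) (d m : nat) (th : net R d m)
  : 'cV[R]_d -> 'cV[R]_m :=
  match th in net _ d m return 'cV[R]_d -> 'cV[R]_m with
  | NLast _ _ W b => fun x => W *m x + b
  | NHidden _ _ _ W b th' => fun x => netPsi sigma th' (map_mx sigma (W *m x + b))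
  end.

Definition netF (R : realType) (sigma : R -> R) (d m : nat) (th : net R d m)
  (x : 'cV[R]_d) : 'cV[R]_m := netPsi sigma th x - netPsi sigma th 0.

(* theta is eps-approximating (w.r.t. F*, DF* and the radius r = 2 Mhat) *)
Definition eps_approximating (R : realType) (sigma : R -> R) (n m : nat)
  (Fs : 'cV[R]_n -> 'cV[R]_m) (DFs : 'cV[R]_n -> 'M[R]_(m, n)) (r : R)
  (th : net R n m) (eps : R) : Prop :=
  forall x : 'cV[R]_n, enorm x <= r ->
    exists2 D : 'M[R]_(m, n), hasDeriv (netF sigma th) D x &
      enorm (Fs x - netF sigma th x) + opnorm (DFs x - D) <= eps.

Definition strongly_measurableW (d : measure_display) (T : measurableType d)
  (R : realType) (mu : {measure set T -> \bar R}) (n : nat)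
  (g : T -> R -> 'cV[R]_n) : Prop :=
  exists s : nat -> T -> R -> 'cV[R]_n,
    (forall k, exists (N : nat) (vals : 'I_N -> R -> 'cV[R]_n) (idx : T -> 'I_N),
        (forall j, Winf (vals j)) /\
        (forall j, measurable (idx @^-1` [set j])) /\
        (forall x, s k x = vals (idx x))) /\
    {ae mu, forall x, (fun k => Wnorm (fun t => s k x t - g x t)) @ \oo --> 0%R}.

Definition LinfW (d : measure_display) (T : measurableType d)
  (R : realType) (mu : {measure set T -> \bar R}) (n : nat)
  (g : T -> R -> 'cV[R]_n) : Prop :=
  strongly_measurableW mu g /\ {ae mu, forall x, Winf (g x)} /\
  (ess_sup mu (fun x => (Wnorm (g x))%:E) < +oo)%E.

Definition LinfW_norm (d : measure_display) (T : measurableType d)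
  (R : realType) (mu : {measure set T -> \bar R}) (n : nat)
  (g : T -> R -> 'cV[R]_n) : \bar R :=
  ess_sup mu (fun x => (Wnorm (g x))%:E).

(* Main.v *)
Require Import Defs.
From HB Require Import structures.
From mathcomp Require Import all_boot all_order all_algebra.
From mathcomp Require Import all_classical all_reals all_analysis.
From mathcomp Require Import ess_sup_inf measurable_realfun.
From mathcomp Require Import ring lra.
Set Implicit Arguments. Unset Strict Implicit. Unset Printing Implicit Defensive.
Import Order.TTheory GRing.Theory Num.Theory.
Import numFieldNormedType.Exports.
Local Open Scope classical_set_scope.
Local Open Scope ring_scope.

(** Write g0 = f + B Fs, g1 = f + B F_theta and A(x) = Df(x) + B DFs(x), and let eta be
    eps times the norm of B. On the ball of radius 2 Mhat, the approximation property
    and the mean value inequality give |g1(x) - g0(x)| <= eta |x|, because both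
    feedbacks vanish at 0, and
      |g1(a) - g1(b) - A(x)(a - b)| <= (eta + L(|a - x| + |b - x|)) |a - b|.
    With ys the optimal trajectory and y = ys + w, the closed-loop system becomes
    w' = A(ys) w + q(w), w(0) = 0, where q(w) = g1(ys + w) - g0(ys) - A(ys) w.
    Assumption 3 solves the linear problem with constant C, and the two bounds make the
    map sending w to the solution with right-hand side q(w) a contraction of the ball of
    radius 4 C eta M|y0| in W_infty once eps is small. The iterates converge uniformly
    in time by the embedding constant, Fatou's lemma puts the limit in L^2, and the
    linear estimate bounds its W_infty norm. Uniqueness in Y_ad is Gronwall's lemma.
    The linear estimate along ys, applied to the difference of two solutions, shows that
    y0 |-> y_eps(y0) is continuous into W_infty, and a continuous map on the compact set
    Y_0 is a limit of simple functions along finite measurable covers. *)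

(** * Euclidean norms and the mean value inequality *)

Section Euclid.
Variable R : realType.
Implicit Types n m : nat.

Definition dotv n (u v : 'cV[R]_n) : R := \sum_(i < n) u i 0 * v i 0.

Lemma enorm_ge0 n (v : 'cV[R]_n) : 0 <= enorm v.
Proof. exact: sqrtr_ge0. Qed.

Lemma sqr_enorm n (v : 'cV[R]_n) : enorm v ^+ 2 = \sum_(i < n) v i 0 ^+ 2.
Proof. by rewrite sqr_sqrtr// sumr_ge0// => i _; exact: sqr_ge0. Qed.

Lemma sqr_enorm_dotv n (v : 'cV[R]_n) : enorm v ^+ 2 = dotv v v.
Proof. by rewrite sqr_enorm; apply: eq_bigr => i _; rewrite expr2. Qed.

Lemma enorm0 n : enorm (0 : 'cV[R]_n) = 0.
Proof.
by rewrite /enorm big1 ?sqrtr0// => i _; rewrite mxE expr0n.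
Qed.

Lemma enormZ n (a : R) (v : 'cV[R]_n) : enorm (a *: v) = `|a| * enorm v.
Proof.
rewrite /enorm -sqrtr_sqr -sqrtrM ?sqr_ge0// mulr_sumr; congr Num.sqrt.
by apply: eq_bigr => i _; rewrite mxE exprMn.
Qed.

Lemma enormN n (v : 'cV[R]_n) : enorm (- v) = enorm v.
Proof. by rewrite -scaleN1r enormZ normrN normr1 mul1r. Qed.

Lemma enormBC n (u v : 'cV[R]_n) : enorm (u - v) = enorm (v - u).
Proof. by rewrite -enormN opprB. Qed.

Lemma coord_le_enorm n (v : 'cV[R]_n) i : `|v i 0| <= enorm v.
Proof.
rewrite -sqrtr_sqr ler_wsqrtr// (bigD1 i)//= lerDl sumr_ge0// => j _.
exact: sqr_ge0.
Qed.

Lemma enorm_le0 n (v : 'cV[R]_n) : enorm v <= 0 -> v = 0.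
Proof.
move=> v0; apply/matrixP => i j; rewrite (ord1 j) mxE.
by apply/eqP; rewrite -normr_le0 (le_trans (coord_le_enorm v i)).
Qed.

(** Cauchy-Schwarz: [t *: u] is the projection of [v] onto the line of [u], and the squared length
    of [v - t *: u] is nonnegative. *)
Lemma dotv_le n (u v : 'cV[R]_n) : dotv u v <= enorm u * enorm v.
Proof.
have [u0|u0] := eqVneq (enorm u) 0.
  rewrite u0 mul0r; have -> : u = 0 by apply: enorm_le0; rewrite u0.
  by rewrite /dotv big1// => i _; rewrite mxE mul0r.
have up : 0 < enorm u ^+ 2 by rewrite exprn_gt0// lt_neqAle eq_sym u0 enorm_ge0.
set t := dotv u v / enorm u ^+ 2.
have : 0 <= enorm (v - t *: u) ^+ 2 by exact: sqr_ge0.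
have -> : enorm (v - t *: u) ^+ 2 =
    enorm v ^+ 2 - 2 * t * dotv u v + t ^+ 2 * enorm u ^+ 2.
  rewrite !sqr_enorm /dotv !mulr_sumr -sumrB -big_split/=.
  by apply: eq_bigr => i _; rewrite !mxE; ring.
have -> : enorm v ^+ 2 - 2 * t * dotv u v + t ^+ 2 * enorm u ^+ 2 =
    (enorm v ^+ 2 * enorm u ^+ 2 - dotv u v ^+ 2) / enorm u ^+ 2.
  by rewrite /t; field.
rewrite pmulr_lge0 ?invr_gt0// subr_ge0 => h.
have [d0|d0] := leP (dotv u v) 0.
  by rewrite (le_trans d0)// mulr_ge0 ?enorm_ge0.
rewrite -(ler_pXn2r (n:=2))// ?nnegrE ?mulr_ge0 ?enorm_ge0 ?(ltW d0)//.
by rewrite exprMn [leRHS]mulrC.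
Qed.

Lemma enormD n (u v : 'cV[R]_n) : enorm (u + v) <= enorm u + enorm v.
Proof.
rewrite -(ler_pXn2r (n:=2))// ?nnegrE ?addr_ge0 ?enorm_ge0//.
have -> : enorm (u + v) ^+ 2 = enorm u ^+ 2 + 2 * dotv u v + enorm v ^+ 2.
  rewrite !sqr_enorm /dotv !mulr_sumr -!big_split/=.
  by apply: eq_bigr => i _; rewrite !mxE; ring.
have := dotv_le u v; nra.
Qed.

Lemma enormB n (u v : 'cV[R]_n) : enorm (u - v) <= enorm u + enorm v.
Proof. by rewrite (le_trans (enormD _ _))// enormN. Qed.

Lemma sqr_enormD n (u v : 'cV[R]_n) :
  enorm (u + v) ^+ 2 <= 2 * enorm u ^+ 2 + 2 * enorm v ^+ 2.
Proof.
rewrite (@le_trans _ _ ((enorm u + enorm v) ^+ 2))//.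
  by rewrite lerXn2r ?nnegrE ?addr_ge0 ?enorm_ge0// enormD.
by rewrite -subr_ge0 (_ : _ - _ = (enorm u - enorm v) ^+ 2) ?sqr_ge0//; ring.
Qed.

(** The crude factor [n], instead of its square root, reduces the count to [n <= n ^ 2]. *)
Lemma enorm_le_coord n (v : 'cV[R]_n) k :
  0 <= k -> (forall i, `|v i 0| <= k) -> enorm v <= n%:R * k.
Proof.
move=> k0 vk; rewrite -(ler_pXn2r (n:=2))// ?nnegrE ?mulr_ge0 ?enorm_ge0//.
rewrite sqr_enorm (@le_trans _ _ (\sum_(i < n) k ^+ 2))//.
  apply: ler_sum => i _; rewrite -real_normK ?num_real//.
  by rewrite lerXn2r ?nnegrE.
rewrite sumr_const card_ord -[_ *+ n]mulr_natl exprMn ler_wpM2r ?sqr_ge0//.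
by rewrite -natrX ler_nat expnS expn1; case: n v vk => // n _ _; rewrite leq_pmulr.
Qed.

(** The Frobenius norm: it bounds the set whose supremum is [opnorm], and later serves as the norm
    of [B]. *)
Definition frob m n (A : 'M[R]_(m, n)) : R :=
  Num.sqrt (\sum_i \sum_j A i j ^+ 2).

Lemma frob_ge0 m n (A : 'M[R]_(m, n)) : 0 <= frob A.
Proof. exact: sqrtr_ge0. Qed.

Lemma enorm_mulmx_frob m n (A : 'M[R]_(m, n)) v :
  enorm (A *m v) <= frob A * enorm v.
Proof.
rewrite -(ler_pXn2r (n:=2))// ?nnegrE ?mulr_ge0 ?enorm_ge0 ?frob_ge0//.
rewrite exprMn [frob A ^+ 2]sqr_sqrtr; last first.
  by rewrite sumr_ge0// => i _; rewrite sumr_ge0// => j _; exact: sqr_ge0.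
rewrite [enorm (_ *m _) ^+ 2]sqr_enorm mulr_suml; apply: ler_sum => i _.
pose a : 'cV[R]_n := \col_j A i j.
have -> : \sum_j A i j ^+ 2 = enorm a ^+ 2.
  by rewrite sqr_enorm; apply: eq_bigr => j _; rewrite mxE.
have -> : (A *m v) i 0 = dotv a v.
  by rewrite mxE; apply: eq_bigr => j _; rewrite mxE.
rewrite -exprMn -real_normK ?num_real// lerXn2r ?nnegrE ?mulr_ge0 ?enorm_ge0//.
rewrite ler_norml dotv_le andbT lerNl.
have -> : - dotv a v = dotv (- a) v.
  by rewrite /dotv -sumrN; apply: eq_bigr => j _; rewrite [(- a) _ _]mxE mulNr.
by rewrite (le_trans (dotv_le _ _))// enormN.
Qed.

(** A [sup] dominates its set only if the set is bounded above, which the Frobenius norm ensures;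
    the test vector is [v] divided by its length. *)
Lemma enorm_mulmx_opnorm m n (A : 'M[R]_(m, n)) v :
  enorm (A *m v) <= opnorm A * enorm v.
Proof.
have [v0|v0] := eqVneq (enorm v) 0.
  have -> : v = 0 by apply: enorm_le0; rewrite v0.
  by rewrite mulmx0 !enorm0 mulr0.
have vp : 0 < enorm v by rewrite lt_neqAle eq_sym v0 enorm_ge0.
rewrite -ler_pdivrMr// -[_ / _]mulrC -[X in X * _]gtr0_norm ?invr_gt0//.
rewrite -enormZ scalemxAr; apply: ub_le_sup.
  exists (frob A) => _ [w /= w1 <-].
  by rewrite (le_trans (enorm_mulmx_frob _ _))// ler_piMr// frob_ge0.
exists ((enorm v)^-1 *: v) => //=.
by rewrite enormZ gtr0_norm ?invr_gt0// mulVf.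
Qed.

Lemma enorm_mulmx_le m n (A : 'M[R]_(m, n)) k v :
  opnorm A <= k -> enorm (A *m v) <= k * enorm v.
Proof.
move=> Ak; rewrite (le_trans (enorm_mulmx_opnorm _ _))//.
by rewrite ler_wpM2r// enorm_ge0.
Qed.

Lemma entry_le m n (A : 'M[R]_(m, n)) k i j :
  (forall v, enorm (A *m v) <= k * enorm v) -> `|A i j| <= k.
Proof.
pose e : 'cV[R]_n := \col_k (k == j)%:R.
have e1 : enorm e = 1.
  rewrite /enorm (bigD1 j)//= big1 ?addr0 => [|l lj].
    by rewrite mxE eqxx expr1n sqrtr1.
  by rewrite mxE (negbTE lj) expr0n.
have -> : A i j = (A *m e) i 0.
  rewrite mxE (bigD1 j)//= big1 ?addr0 => [|l lj]; first by rewrite mxE eqxx mulr1.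
  by rewrite mxE (negbTE lj) mulr0.
by move=> /(_ e); rewrite e1 mulr1; apply: le_trans; exact: coord_le_enorm.
Qed.

(** Differentiability is relative to [[0, 1]], one-sided at the end points, since a derivative
    within a closed ball gives no more along a segment. The interior still gets ordinary derivatives
    and the end points continuity, as the classical theorem requires. *)
Lemma MVT_unit_itv (g : R -> R) (l : R -> R) :
  (forall s : R, 0 <= s <= 1 -> forall e : R, 0 < e -> exists2 d : R, 0 < d &
     forall z : R, 0 <= z <= 1 -> `|z - s| < d ->
       `|g z - g s - l s * (z - s)| <= e * `|z - s|) ->
  exists2 c : R, 0 <= c <= 1 & g 1 - g 0 = l c.
Proof.
move=> H.
have der (x : R) : x \in `]0, 1[ -> is_derive x 1 g (l x).
  move=> x01; have x01' : 0 <= x <= 1 by rewrite !(itvP x01).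
  apply/is_derive1_caratheodory.
  (* Caratheodory's slope function: the difference quotient, completed by [l x] at [x]. *)
  exists (fun z => if z == x then l x else (g z - g x) / (z - x)); split.
  - move=> z; case: eqVneq => [->|zx]; first by rewrite !subrr mulr0.
    by rewrite divfK// subr_eq0.
  - apply/cvgrPdist_le => /= e e0; rewrite eqxx.
    have [d d0 hd] := H _ x01' _ e0.
    near=> z; case: eqVneq => [_|zx]; first by rewrite subrr normr0 ltW.
    have zx0 : 0 < `|z - x| by rewrite normr_gt0 subr_eq0.
    rewrite -(ler_pM2r zx0) -normrM mulrBl divfK ?subr_eq0// distrC.
    have z01 : z \in `]0, 1[ by near: z; exact: near_in_itvoo.
    apply: hd; first by rewrite !(itvP z01).
    rewrite distrC; near: z; exact: cvgr_dist_lt.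
  - by rewrite eqxx.
have cont : {within `[0, 1], continuous g}.
  apply/subspace_continuousP => x; rewrite /= in_itv/= => x01.
  apply/cvgrPdist_lt => /= e e0.
  have [d d0 hd] := H _ x01 _ (@ltr01 R).
  have K0 : 0 < `|l x| + 1 by rewrite ltr_wpDl.
  rewrite near_withinE; near=> z => /=; rewrite in_itv/= => z01.
  have zd : `|z - x| < d by rewrite distrC; near: z; exact: cvgr_dist_lt.
  have ze : `|z - x| < e / (`|l x| + 1).
    by rewrite distrC; near: z; apply: cvgr_dist_lt => //; rewrite divr_gt0.
  move: ze; rewrite ltr_pdivlMr// => ze.
  rewrite distrC (le_lt_trans _ ze)//.
  have := hd z z01 zd; rewrite mul1r => h.
  have -> : g z - g x = (g z - g x - l x * (z - x)) + l x * (z - x) by ring.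
  rewrite (le_trans (ler_normD _ _))// normrM; lra.
have [c c01 hc] := MVT (@ltr01 R) der cont.
by exists c; rewrite ?(itvP c01)// hc subr0 mulr1.
Unshelve. all: by end_near. Qed.

(** Pairing with the error vector [e] itself makes the problem scalar: the mean value theorem for
    [g] gives [enorm e ^+ 2 = dotv e ((D c - A) *m (a - b))], and Cauchy-Schwarz cancels one factor
    [enorm e]. Only derivatives within [K] occur, so that the closed ball of (A.4) is allowed. *)
Lemma mean_value_ineq n m (K : set 'cV[R]_n) (G : 'cV[R]_n -> 'cV[R]_m)
    (A : 'M[R]_(m, n)) a b k :
  0 <= k ->
  (forall s : R, 0 <= s <= 1 -> K (b + s *: (a - b))) ->
  (forall s : R, 0 <= s <= 1 -> exists2 D, hasDerivWithin K G D (b + s *: (a - b)) &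
    forall v, enorm ((D - A) *m v) <= k * enorm v) ->
  enorm (G a - G b - A *m (a - b)) <= k * enorm (a - b).
Proof.
move=> k0 segK H; set p := fun s : R => b + s *: (a - b).
set e := G a - G b - A *m (a - b).
have /choice[D HD] : forall s : R, exists D : 'M[R]_(m, n), 0 <= s <= 1 ->
    hasDerivWithin K G D (p s) /\ forall v, enorm ((D - A) *m v) <= k * enorm v.
  move=> s; have [s01|s01] := boolP (0 <= s <= 1); last by exists 0.
  by have [D ? ?] := H s s01; exists D.
pose g s := dotv e (G (p s) - s *: (A *m (a - b))).
pose l s := dotv e ((D s - A) *m (a - b)).
have [|c c01] := @MVT_unit_itv g l.
  move=> s s01 e' e'0.
  (* The summand [1] keeps the divisors positive when [e = 0] or [a = b]. *)
  have K0 : 0 < enorm e * enorm (a - b) + 1.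
    by rewrite ltr_wpDl// mulr_ge0// enorm_ge0.
  have [d d0 hd] := (HD s s01).1 (e' / (enorm e * enorm (a - b) + 1)) (divr_gt0 e'0 K0).
  have N1 : 0 < enorm (a - b) + 1 by rewrite ltr_wpDl// enorm_ge0.
  exists (d / (enorm (a - b) + 1)); first by rewrite divr_gt0.
  move=> z z01; rewrite ltr_pdivlMr// => zs.
  have pzs : p z - p s = (z - s) *: (a - b).
    by rewrite /p opprD addrACA subrr add0r scalerBl.
  have zsd : enorm (p z - p s) < d.
    by rewrite pzs enormZ (le_lt_trans _ zs)// ler_wpM2l// lerDl ler01.
  have := hd (p z) (segK z z01) zsd; rewrite pzs enormZ => h.
  have -> : g z - g s - l s * (z - s) =
      dotv e (G (p z) - G (p s) - D s *m ((z - s) *: (a - b))).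
    rewrite [l s * _]mulrC /g /l /dotv mulr_sumr -!sumrB; apply: eq_bigr => i _.
    rewrite -scalemxAr mulmxBl !mxE; ring.
  have dotv_norm (u w : 'cV[R]_m) : `|dotv u w| <= enorm u * enorm w.
    rewrite ler_norml dotv_le andbT lerNl.
    have -> : - dotv u w = dotv (- u) w.
      by rewrite /dotv -sumrN; apply: eq_bigr => j _; rewrite [(- u) _ _]mxE mulNr.
    by rewrite (le_trans (dotv_le _ _))// enormN.
  rewrite (le_trans (dotv_norm _ _))//.
  rewrite (le_trans (ler_wpM2l (enorm_ge0 _) h))//.
  have -> : enorm e * (e' / (enorm e * enorm (a - b) + 1) * (`|z - s| * enorm (a - b)))
    = (e' * `|z - s|) * ((enorm e * enorm (a - b)) / (enorm e * enorm (a - b) + 1)).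
    by ring.
  rewrite ler_piMr// ?mulr_ge0// ?ltW// ltr_pdivrMr//; lra.
have [_ hDc] := HD c c01.
have -> : g 1 - g 0 = enorm e ^+ 2.
  rewrite sqr_enorm_dotv /g /dotv -sumrB; apply: eq_bigr => i _.
  rewrite -mulrBr; congr (_ * _).
  by rewrite /p scale1r scale0r addr0 subrKC scale1r scale0r subr0 /e !mxE; ring.
move=> he.
have [e0|e0] := eqVneq (enorm e) 0; first by rewrite e0 mulr_ge0// enorm_ge0.
have ep : 0 < enorm e by rewrite lt_neqAle eq_sym e0 enorm_ge0.
rewrite -(ler_pM2l ep) -expr2 he (le_trans (dotv_le _ _))//.
by rewrite ler_pM2l.
Qed.

Lemma segment_dist n (a b x : 'cV[R]_n) (s : R) : 0 <= s <= 1 ->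
  enorm (b + s *: (a - b) - x) <= (1 - s) * enorm (b - x) + s * enorm (a - x).
Proof.
move=> /andP[s0 s1].
have -> : b + s *: (a - b) - x = (1 - s) *: (b - x) + s *: (a - x).
  by apply/matrixP => i j; rewrite !mxE; ring.
by rewrite (le_trans (enormD _ _))// !enormZ !ger0_norm// subr_ge0.
Qed.

Lemma segment_cball0 n r (a b : 'cV[R]_n) (s : R) : 0 <= s <= 1 ->
  cball0 r a -> cball0 r b -> cball0 r (b + s *: (a - b)).
Proof.
rewrite /cball0/= => s01 ar br; have := segment_dist a b 0 s01.
rewrite !subr0 => h; case/andP: s01 => s0 s1; rewrite (le_trans h)//.
have h1 : (1 - s) * enorm b <= (1 - s) * r by rewrite ler_wpM2l// subr_ge0.
have h2 : s * enorm a <= s * r by rewrite ler_wpM2l.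
lra.
Qed.

Lemma segment_dist_le n (a b x : 'cV[R]_n) (s : R) : 0 <= s <= 1 ->
  enorm (b + s *: (a - b) - x) <= enorm (a - x) + enorm (b - x).
Proof.
move=> s01; rewrite (le_trans (segment_dist _ _ _ s01))//.
case/andP: s01 => s0 s1; rewrite addrC lerD// ler_piMl ?enorm_ge0//.
by rewrite lerBlDr lerDl.
Qed.

Lemma hasDerivWithinS n m (K K' : set 'cV[R]_n) (F : 'cV[R]_n -> 'cV[R]_m) D x :
  K `<=` K' -> hasDerivWithin K' F D x -> hasDerivWithin K F D x.
Proof.
move=> KK' H e e0; have [d d0 Hd] := H e e0.
by exists d => // z Kz; apply: Hd; exact: KK'.
Qed.

Lemma hasDerivWithinB n m (K : set 'cV[R]_n) (F G : 'cV[R]_n -> 'cV[R]_m) D E x :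
  hasDerivWithin K F D x -> hasDerivWithin K G E x ->
  hasDerivWithin K (fun z => F z - G z) (D - E) x.
Proof.
move=> HF HG e e0; have e20 : 0 < e / 2 by rewrite divr_gt0.
have [d d0 Hd] := HF _ e20; have [d' d'0 Hd'] := HG _ e20.
exists (Num.min d d'); first by rewrite lt_min d0.
move=> z Kz; rewrite lt_min => /andP[zd zd'].
have -> : F z - G z - (F x - G x) - (D - E) *m (z - x) =
   (F z - F x - D *m (z - x)) - (G z - G x - E *m (z - x)).
  rewrite mulmxBl; move: (_ *m _) (_ *m _) => u v.
  by apply/matrixP => i j; rewrite !mxE; ring.
rewrite (le_trans (enormB _ _))//.
by have := Hd z Kz zd; have := Hd' z Kz zd'; lra.
Qed.

Definition vcont_on n m (K : set 'cV[R]_n) (F : 'cV[R]_n -> 'cV[R]_m) : Prop :=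
  forall x, K x -> forall e : R, 0 < e -> exists2 d : R, 0 < d &
    forall z, K z -> enorm (z - x) < d -> enorm (F z - F x) <= e.

Lemma hasDerivWithin_vcont n m (K : set 'cV[R]_n) (F : 'cV[R]_n -> 'cV[R]_m) :
  (forall x, K x -> exists D, hasDerivWithin K F D x) -> vcont_on K F.
Proof.
move=> H x Kx e e0; have [D HD] := H x Kx.
have [d d0 Hd] := HD 1 ltr01.
have D1 : 0 < frob D + 1 by rewrite ltr_wpDl// frob_ge0.
exists (Num.min d (e / (frob D + 1))); first by rewrite lt_min d0 divr_gt0.
move=> z Kz; rewrite lt_min ltr_pdivlMr// => /andP[zd ze].
rewrite -[F z - F x](subrK (D *m (z - x))) (le_trans (enormD _ _))//.
by have := Hd z Kz zd; have := enorm_mulmx_frob D (z - x); lra.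
Qed.

Lemma vcont_onD_mulmx n m p (K : set 'cV[R]_n) (F : 'cV[R]_n -> 'cV[R]_m)
    (G : 'cV[R]_n -> 'cV[R]_p) (B : 'M[R]_(m, p)) :
  vcont_on K F -> vcont_on K G -> vcont_on K (fun x => F x + B *m G x).
Proof.
move=> HF HG x Kx e e0.
have B1 : 0 < frob B + 1 by rewrite ltr_wpDl// frob_ge0.
have e20 : 0 < e / 2 by rewrite divr_gt0.
have [d d0 Hd] := HF x Kx _ e20.
have [d' d'0 Hd'] := HG x Kx _ (divr_gt0 e20 B1).
exists (Num.min d d'); first by rewrite lt_min d0.
move=> z Kz; rewrite lt_min => /andP[zd zd'].
have -> : F z + B *m G z - (F x + B *m G x) = F z - F x + B *m (G z - G x).
  by rewrite mulmxBr opprD addrACA.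
rewrite (le_trans (enormD _ _))//; have := Hd z Kz zd.
have := Hd' z Kz zd'; rewrite ler_pdivlMr// => h1.
have := enorm_mulmx_frob B (G z - G x).
have := enorm_ge0 (G z - G x); lra.
Qed.

End Euclid.

(** * Square-integrable functions on the half line *)

Import HBNNSimple.

Section L2.
Variable R : realType.
Implicit Types n : nat.
Local Notation mu := (leb R).

Lemma measurable_Itime : measurable (Itime R).
Proof. exact: measurable_itv. Qed.

Lemma Itime_ge0 (t : R) : Itime R t <-> 0 <= t.
Proof. by rewrite /Itime /= in_itv/= andbT. Qed.

Lemma ae_imply (P Q : R -> Prop) : (forall x, P x -> Q x) ->
  {ae mu, forall x, P x} -> {ae mu, forall x, Q x}.
Proof.
move=> PQ; apply: filterS; first exact: (ae_filter_ringOfSetsType mu).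
exact: PQ.
Qed.

Lemma ae_imply2 (P Q S : R -> Prop) : (forall x, P x -> Q x -> S x) ->
  {ae mu, forall x, P x} -> {ae mu, forall x, Q x} -> {ae mu, forall x, S x}.
Proof.
move=> PQS; apply: filterS2; first exact: (ae_filter_ringOfSetsType mu).
exact: PQS.
Qed.

Lemma ae_forall_fin (T : finType) (P : T -> R -> Prop) :
  (forall i, {ae mu, forall x, P i x}) -> {ae mu, forall x, forall i, P i x}.
Proof.
move=> h; exact: (@filter_forall _ T P _ (ae_filter_ringOfSetsType mu) h).
Qed.

(* The integral of a nonnegative function is a supremum over simple functions, hence
   insensitive to null sets even when [f] is not known to be measurable; this spares
   the measurability of [Wdot]. *)
Lemma ge0_ae_eq_lower_integral (D : set R) (f g : R -> \bar R) :
  measurable D -> measurable_fun D g ->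
  (forall x, D x -> (0 <= f x)%E) -> (forall x, D x -> (0 <= g x)%E) ->
  {ae mu, forall x, D x -> f x = g x} ->
  (\int[mu]_(x in D) f x = \int[mu]_(x in D) g x)%E.
Proof.
move=> mD mg f0 g0 fg; apply/eqP; rewrite eq_le; apply/andP; split.
  rewrite (ge0_integralE mu f0); apply: ub_ereal_sup => _ [h /= hf <-].
  rewrite -integralT_nnsfun [leRHS]integral_mkcond.
  apply: ae_ge0_le_integral => //.
  - by move=> x _; rewrite lee_fin; exact: fun_ge0.
  - exact/measurable_EFinP/measurable_funP.
  - by move=> x _; apply: erestrict_ge0.
  - exact/(measurable_restrictT _ _).1.
  - move: fg; apply: ae_imply => x fgx _; rewrite (le_trans (hf x))//.
    by rewrite !patchE; case: ifPn => // /set_mem Dx; rewrite fgx.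
case: fg => N [mN N0 subN].
rewrite (ge0_negligible_integral mN mD mg g0 N0).
rewrite ge0_integralE; last by move=> x [Dx _]; exact: g0.
rewrite ge0_integralE//; apply: ereal_sup_le => _ [h /= hg <-].
exists h => // x; rewrite (le_trans (hg x))//.
rewrite !patchE; case: ifPn => [/set_mem[Dx Nx]|_].
  rewrite mem_set//; have [->//|fgx] := pselect (f x = g x).
  by exfalso; apply/Nx/subN => /= /(_ Dx).
by case: ifPn => // /set_mem; exact: f0.
Qed.

Lemma measurable_sqr_enorm n (D : set R) (y : R -> 'cV[R]_n) :
  (forall i, measurable_fun D (fun t => y t i 0)) ->
  measurable_fun D (fun t => (enorm (y t) ^+ 2)%:E).
Proof.
move=> my; apply/measurable_EFinP.
under eq_fun do rewrite sqr_enorm.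
by apply: measurable_sum => i; exact: measurable_funX.
Qed.

Definition L2sq n (y : R -> 'cV[R]_n) : R := fine (L2sqE y).

Lemma L2sqE_ge0 n (y : R -> 'cV[R]_n) : (0 <= L2sqE y)%E.
Proof. by apply: integral_ge0 => t _; rewrite lee_fin sqr_ge0. Qed.

Lemma L2sq_ge0 n (y : R -> 'cV[R]_n) : 0 <= L2sq y.
Proof. exact/fine_ge0/L2sqE_ge0. Qed.

Lemma L2sqEE n (y : R -> 'cV[R]_n) : L2fun y -> L2sqE y = (L2sq y)%:E.
Proof. by move=> [_ yoo]; rewrite fineK// ge0_fin_numE// L2sqE_ge0. Qed.

(** Integrals are additive in squares, so a pointwise bound between squares gives membership and
    norm bound at once. *)
Lemma L2fun_le n p q (y : R -> 'cV[R]_n) (z : R -> 'cV[R]_p) (x : R -> 'cV[R]_q) (a b : R) :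
  L2fun z -> L2fun x -> 0 <= a -> 0 <= b ->
  (forall i, measurable_fun (Itime R) (fun t => y t i 0)) ->
  (forall t, Itime R t ->
    enorm (y t) ^+ 2 <= a * enorm (z t) ^+ 2 + b * enorm (x t) ^+ 2) ->
  L2fun y /\ L2sq y <= a * L2sq z + b * L2sq x.
Proof.
move=> Lz Lx a0 b0 my yle.
have mI := measurable_Itime.
have mz := measurable_sqr_enorm Lz.1; have mx := measurable_sqr_enorm Lx.1.
have h : (L2sqE y <= (a * L2sq z + b * L2sq x)%:E)%E.
  rewrite EFinD !EFinM -!L2sqEE// -!ge0_integralZl_EFin//=.
  rewrite -ge0_integralD//=.
  - apply: ge0_le_integral => //=.
    + by move=> t _; rewrite lee_fin sqr_ge0.
    + exact: measurable_sqr_enorm.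
    + by apply: emeasurable_funD; exact: measurable_funeM.
  - by move=> t _; rewrite -EFinM lee_fin mulr_ge0// sqr_ge0.
  - exact: measurable_funeM.
  - by move=> t _; rewrite -EFinM lee_fin mulr_ge0// sqr_ge0.
  - exact: measurable_funeM.
  - by move=> t _; rewrite lee_fin sqr_ge0.
  - by move=> t _; rewrite lee_fin sqr_ge0.
have Ly : L2fun y by split => //; rewrite (le_lt_trans h)// ltry.
by split => //; rewrite -lee_fin -L2sqEE.
Qed.

Lemma L2fun0 n : L2fun (fun=> 0 : 'cV[R]_n).
Proof.
split=> [i|]; first by under eq_fun do rewrite mxE; exact: measurable_cst.
rewrite /L2sqE; under eq_integral do rewrite enorm0 expr0n/=.
by rewrite integral0.
Qed.

Lemma L2norm_le1 n p (y : R -> 'cV[R]_n) (z : R -> 'cV[R]_p) (a : R) :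
  L2fun z -> 0 <= a ->
  (forall i, measurable_fun (Itime R) (fun t => y t i 0)) ->
  (forall t, Itime R t -> enorm (y t) <= a * enorm (z t)) ->
  L2fun y /\ L2norm y <= a * L2norm z.
Proof.
move=> Lz a0 my yle.
have [t It|Ly h] := @L2fun_le _ _ _ y z z (a ^+ 2) 0 Lz Lz (sqr_ge0 a) (lexx 0) my.
  rewrite mul0r addr0 -exprMn lerXn2r ?nnegrE ?mulr_ge0 ?enorm_ge0//.
  exact: yle.
split => //; rewrite mul0r addr0 in h.
rewrite /L2norm -[X in X * _](ger0_norm a0) -sqrtr_sqr -sqrtrM ?sqr_ge0//.
exact: ler_wsqrtr.
Qed.

(** A substitute for Minkowski's inequality, from [(s + t)^2 <= 2 s^2 + 2 t^2]; its price is the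
    factor 2, which reappears in the fixed-point estimates. *)
Lemma L2norm_le2 n p q (y : R -> 'cV[R]_n) (z : R -> 'cV[R]_p) (x : R -> 'cV[R]_q) (a b : R) :
  L2fun z -> L2fun x -> 0 <= a -> 0 <= b ->
  (forall i, measurable_fun (Itime R) (fun t => y t i 0)) ->
  (forall t, Itime R t -> enorm (y t) <= a * enorm (z t) + b * enorm (x t)) ->
  L2fun y /\ L2norm y <= 2 * (a * L2norm z + b * L2norm x).
Proof.
move=> Lz Lx a0 b0 my yle.
have p2 (c : R) : 0 <= 2 * c ^+ 2 by rewrite mulr_ge0// sqr_ge0.
have [t It|Ly h] := L2fun_le Lz Lx (p2 a) (p2 b) my.
  have := yle t It; have := enorm_ge0 (y t); set Y := enorm _; set Z := enorm _.
  set X := enorm _ => Y0 YZX.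
  rewrite (@le_trans _ _ ((a * Z + b * X) ^+ 2))//.
    by rewrite lerXn2r ?nnegrE// (le_trans Y0).
  rewrite -subr_ge0 (_ : _ - _ = (a * Z - b * X) ^+ 2) ?sqr_ge0//; ring.
split => //.
have z2 : L2norm z ^+ 2 = L2sq z by rewrite sqr_sqrtr// L2sq_ge0.
have x2 : L2norm x ^+ 2 = L2sq x by rewrite sqr_sqrtr// L2sq_ge0.
have zp : 0 <= L2norm z by exact: sqrtr_ge0.
have xp : 0 <= L2norm x by exact: sqrtr_ge0.
have S0 : 0 <= a * L2norm z + b * L2norm x by rewrite addr_ge0// mulr_ge0.
rewrite -(ler_pXn2r (n:=2))// ?nnegrE ?sqrtr_ge0 ?mulr_ge0//.
rewrite [L2norm y ^+ 2]sqr_sqrtr ?L2sq_ge0// (le_trans h)// -z2 -x2.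
have az : 0 <= a * L2norm z by rewrite mulr_ge0.
have bx : 0 <= b * L2norm x by rewrite mulr_ge0.
rewrite -subr_ge0 (_ : _ - _ = 2 * (a * L2norm z) ^+ 2 + 2 * (b * L2norm x) ^+ 2
  + 8 * ((a * L2norm z) * (b * L2norm x))); last by ring.
by rewrite !addr_ge0// ?mulr_ge0// ?sqr_ge0.
Qed.

Lemma measurable_lin n (D : set R) a (y z : R -> 'cV[R]_n) :
  (forall i, measurable_fun D (fun t => y t i 0)) ->
  (forall i, measurable_fun D (fun t => z t i 0)) ->
  forall i, measurable_fun D (fun t => (a *: y t + z t) i 0).
Proof.
move=> my mz i; under eq_fun do rewrite !mxE.
by apply: measurable_funD => //; exact: measurable_funM.
Qed.

Lemma L2fun_lin n a (y z : R -> 'cV[R]_n) :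
  L2fun y -> L2fun z -> L2fun (fun t => a *: y t + z t).
Proof.
move=> Ly Lz.
have p2 (c : R) : 0 <= 2 * c ^+ 2 by rewrite mulr_ge0// sqr_ge0.
have [t It|//] := L2fun_le Ly Lz (p2 a) (ler0n _ 2) (measurable_lin a Ly.1 Lz.1).
  rewrite (le_trans (sqr_enormD _ _))// enormZ exprMn real_normK ?num_real//.
  by rewrite mulrA.
Qed.

(** On a set of finite measure, [1 + enorm (v t) ^+ 2] dominates each coordinate. Extending by zero
    off the half line lets [K] be any such set, as local integrability on the whole line demands. *)
Lemma L2fun_integrable n (v : R -> 'cV[R]_n) i (K : set R) :
  L2fun v -> measurable K -> (mu K < +oo)%E ->
  mu.-integrable K (EFin \o ((fun t => v t i 0) \_ (Itime R))).
Proof.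
move=> Lv mK Koo; have mI := measurable_Itime.
pose h := (fun t => (enorm (v t) ^+ 2)) \_ (Itime R).
have hint : mu.-integrable setT (EFin \o h).
  rewrite -restrict_EFin; apply/(integrable_mkcond _ _).1 => //.
  apply/integrableP; split; first exact: measurable_sqr_enorm Lv.1.
  under eq_integral do rewrite /= ger0_norm ?sqr_ge0//.
  exact: Lv.2.
apply: (@le_integrable _ _ _ mu K mK _ (fun x => 1%:E + (h x)%:E)%E).
- apply/measurable_EFinP/(measurable_funS measurableT (@subsetT _ _)).
  by apply/(measurable_restrictT _ _).1 => //; exact: Lv.1.
- move=> t _; suff : `|((fun t => v t i 0) \_ (Itime R)) t| <= `|1 + h t|.
    by rewrite -lee_fin.
  have h0 : 0 <= h t by rewrite /h patchE; case: ifP => //; rewrite sqr_ge0.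
  rewrite [leRHS]ger0_norm ?addr_ge0// /h !patchE; case: ifP => _; last first.
    by rewrite normr0 addr0.
  have := coord_le_enorm (v t) i; set e := enorm _; set c := `|_| => ce.
  have : 0 <= (e - 1) ^+ 2 by exact: sqr_ge0.
  have : 0 <= e by exact: enorm_ge0.
  nra.
- apply: integrableD => //.
  + apply/integrableP; split; first exact: measurable_cst.
    rewrite (eq_integral (cst 1%E)); last by move=> t _; rewrite /= normr1.
    by rewrite integral_cst// mul1e.
  + exact: integrableS hint.
Qed.

Lemma L2fun_integrable_itv n (v : R -> 'cV[R]_n) i (a b : R) (ba bb : bool) : 0 <= a ->
  L2fun v -> mu.-integrable [set` Interval (BSide ba a) (BSide bb b)]
    (EFin \o (fun t => v t i 0)).
Proof.
move=> a0 Lv.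
have := @L2fun_integrable n v i [set` Interval (BSide ba a) (BSide bb b)] Lv _ _.
have moo : (mu [set` Interval (BSide ba a) (BSide bb b)] < +oo)%E.
  by rewrite lebesgue_measure_itv/=; case: ifP => // _; rewrite -EFinD ltry.
move=> /(_ (measurable_itv _) moo).
apply: eq_integrable => // t; rewrite inE/= => tab.
rewrite patchE mem_set//; apply/Itime_ge0; rewrite (le_trans a0)//.
move: tab {moo}; rewrite itv_boundlr => /andP[+ _].
by case: ba => /=; rewrite bnd_simp// => /ltW.
Qed.

Lemma vint_lin n a (v u : R -> 'cV[R]_n) t : L2fun v -> L2fun u ->
  vint (fun s => a *: v s + u s) 0 t = a *: vint v 0 t + vint u 0 t.
Proof.
move=> Lv Lu; apply/matrixP => i j; rewrite !mxE.
under eq_Rintegral do rewrite !mxE.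
have iv := L2fun_integrable_itv i t true false (lexx 0) Lv.
have iu := L2fun_integrable_itv i t true false (lexx 0) Lu.
rewrite RintegralD//; first by rewrite RintegralZl.
have : mu.-integrable `[0, t] (fun x => a%:E * (v x i 0)%:E)%E by exact: integrableZl.
by apply: eq_integrable => // s _; rewrite /= EFinM.
Qed.

Lemma vint_sub_le n (v : R -> 'cV[R]_n) i (a t K : R) : L2fun v ->
  0 <= a -> a <= t -> (forall s, a <= s <= t -> `|v s i 0| <= K) ->
  `|vint v 0 t i 0 - vint v 0 a i 0| <= K * (t - a).
Proof.
move=> Lv a0 at_ vK; rewrite !mxE Rintegral_itvB; last 3 first.
- exact: L2fun_integrable_itv.
- by rewrite bnd_simp.
- by rewrite bnd_simp.
have iv := L2fun_integrable_itv i t false false a0 Lv.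
have moo : fine (mu [set` Interval (BRight a) (BRight t)]) = t - a.
  rewrite lebesgue_measure_itv/= lte_fin; case: ltP => //= ta.
  by apply/esym/eqP; rewrite subr_eq0 eq_le ta.
rewrite (le_trans (le_normr_Rintegral _ iv))// -moo -Rintegral_cst//.
apply: le_Rintegral => //.
- exact: (integrable_norm iv).
- apply/integrableP; split; first exact: measurable_cst.
  rewrite integral_cst//= lebesgue_measure_itv/=.
  by case: ifP => _; rewrite ?mule0 ?ltry// -EFinD -EFinM ltry.
- move=> s /=; rewrite in_itv/= => /andP[/ltW as_ st].
  by apply: vK; rewrite as_.
Qed.

End L2.

(** * The space W_infty *)

Section Wspace.
Variable R : realType.
Implicit Types n : nat.
Local Notation mu := (leb R).

(* Carrying the density [v] avoids the derivative [Wdot y], which equals [v] only almost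
   everywhere ([Wrep_ae]). *)
Definition Wrep n (y v : R -> 'cV[R]_n) : Prop :=
  [/\ L2fun y, L2fun v & forall t, Itime R t -> y t = y 0 + vint v 0 t].

Lemma Winf_Wrep n (y : R -> 'cV[R]_n) : Winf y <-> exists v, Wrep y v.
Proof.
split=> [[Ly [v Lv yv]]|[v [Ly Lv yv]]]; first by exists v.
by split => //; exists v.
Qed.

Lemma Wrep_Winf n (y v : R -> 'cV[R]_n) : Wrep y v -> Winf y.
Proof. by move=> yv; apply/Winf_Wrep; exists v. Qed.

(** Time 0 has to be discarded: the derivative there is two-sided and sees negative times, where a
    trajectory is arbitrary. *)
Lemma ae_neq0 : {ae mu, forall t : R, t != 0}.
Proof.
exists [set 0]; split => [||t /= /negP]; first exact: measurable_set1.
  exact: lebesgue_measure_set1.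
by rewrite negbK => /eqP.
Qed.

(** Lebesgue's differentiation theorem, applied to each coordinate of the density extended by
    zero. *)
Lemma Wrep_ae n (y v : R -> 'cV[R]_n) : Wrep y v ->
  {ae mu, forall t, Itime R t -> Wdot y t = v t}.
Proof.
move=> [Ly Lv yv].
suff H i : {ae mu, forall t : R, 0 < t -> derive1 (fun s => y s i 0) t = v t i 0}.
  apply: ae_imply2 (ae_forall_fin H) ae_neq0 => t Ht t0 /Itime_ge0 t0'.
  apply/matrixP => i j; rewrite mxE (ord1 j); apply: Ht.
  by rewrite lt_neqAle eq_sym t0.
pose v0 := (fun t => v t i 0) \_ (Itime R).
have loc : locally_integrable setT v0.
  split.
  - by apply/(measurable_restrictT _ _).1; [exact: measurable_Itime|exact: Lv.1].
  - exact: openT.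
  - move=> K _ cK.
    have /integrableP[_ +] := L2fun_integrable i Lv (compact_measurable cK)
      (compact_finite_measure cK).
    by [].
have intv (x : R) : mu.-integrable [set` Interval (BLeft 0) (BRight x)] (EFin \o v0).
  apply: L2fun_integrable => //=.
  by rewrite lebesgue_measure_itv/=; case: ifP => // _; rewrite -EFinD ltry.
apply: ae_imply (FTC1 intv loc) => t Ht t0.
have [|dF F'] := Ht; first by rewrite lte_fin.
rewrite (@derive1E _ R^o).
(* The integral formula holds on a full neighbourhood of [t] because [t] is positive, so it may
   replace [y] under the derivative. *)
rewrite (@near_eq_derive _ _ _ _ (fun s : R => y 0 i 0 +
  (\int[mu]_(r in [set` Interval (BLeft 0%R) (BRight s)]) v0 r)%R)); last first.
  near=> s.
  have s0 : 0 < s by near: s; exact: lt_nbhsr.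
  have Is : Itime R s by apply/Itime_ge0/ltW.
  rewrite yv// mxE mxE; congr (_ + _).
  apply: eq_Rintegral => r; rewrite inE/= in_itv/= => /andP[r0 _].
  by rewrite /v0 patchE mem_set//; apply/Itime_ge0.
rewrite deriveD//= derive_cst add0r -derive1E F' /v0 patchE mem_set//.
exact/Itime_ge0/ltW.
Unshelve. all: by end_near. Qed.

Lemma L2sqE_ae n (y v : R -> 'cV[R]_n) :
  (forall i, measurable_fun (Itime R) (fun t => v t i 0)) ->
  {ae mu, forall t, Itime R t -> y t = v t} -> L2sqE y = L2sqE v.
Proof.
move=> mv yv; apply: ge0_ae_eq_lower_integral.
- exact: measurable_Itime.
- exact: measurable_sqr_enorm.
- by move=> t _; rewrite lee_fin sqr_ge0.
- by move=> t _; rewrite lee_fin sqr_ge0.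
- by apply: ae_imply yv => t H It; rewrite H.
Qed.

(** Lets every later computation use the density instead of the classical derivative in [Wnorm]. *)
Lemma sqr_Wnorm n (y v : R -> 'cV[R]_n) : Wrep y v ->
  Wnorm y ^+ 2 = L2sq y + L2sq v.
Proof.
move=> yv; have [_ Lv _] := yv; rewrite sqr_sqrtr; last first.
  by rewrite addr_ge0// fine_ge0// L2sqE_ge0.
by rewrite (L2sqE_ae Lv.1 (Wrep_ae yv)).
Qed.

Lemma Wnorm_ge0 n (y : R -> 'cV[R]_n) : 0 <= Wnorm y.
Proof. exact: sqrtr_ge0. Qed.

Lemma L2norm_le_Wnorm n (y : R -> 'cV[R]_n) : L2norm y <= Wnorm y.
Proof. by rewrite ler_wsqrtr// lerDl fine_ge0// L2sqE_ge0. Qed.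

Lemma Wrep_eqI n (y z v : R -> 'cV[R]_n) : eqI y z -> Wrep y v -> Wrep z v.
Proof.
move=> yz [Ly Lv yv]; have I0 : Itime R 0 by apply/Itime_ge0.
split => //; last by move=> t It; rewrite -!yz// yv.
split=> [i|].
  by apply: eq_measurable_fun (Ly.1 i) => t /set_mem It; rewrite yz.
rewrite (_ : L2sqE z = L2sqE y); first exact: Ly.2.
by apply: eq_integral => t /set_mem It; rewrite yz.
Qed.

(** Agreement on the half line does not force equal derivatives at 0, so the two norms are compared
    through a common density. *)
Lemma Wnorm_eqI n (y z : R -> 'cV[R]_n) : Winf y -> eqI y z -> Wnorm z = Wnorm y.
Proof.
move=> /Winf_Wrep[v yv] yz; have zv := Wrep_eqI yz yv.
suff H : Wnorm z ^+ 2 = Wnorm y ^+ 2.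
  by rewrite -[LHS](ger0_norm (Wnorm_ge0 z)) -sqrtr_sqr H sqrtr_sqr ger0_norm ?Wnorm_ge0.
have E : L2sqE z = L2sqE y by apply: eq_integral => t /set_mem It; rewrite yz.
by rewrite [LHS](sqr_Wnorm zv) [RHS](sqr_Wnorm yv) /L2sq E.
Qed.

Lemma Wrep_lin n a (y v z u : R -> 'cV[R]_n) : Wrep y v -> Wrep z u ->
  Wrep (fun t => a *: y t + z t) (fun t => a *: v t + u t).
Proof.
move=> [Ly Lv yv] [Lz Lu zu]; split; [exact: L2fun_lin|exact: L2fun_lin|].
by move=> t It; rewrite vint_lin// yv// zu// scalerDr addrACA.
Qed.

Lemma WrepB n (y v z u : R -> 'cV[R]_n) : Wrep y v -> Wrep z u ->
  Wrep (fun t => y t - z t) (fun t => v t - u t).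
Proof.
move=> yv zu; have := Wrep_lin (-1) zu yv.
by congr Wrep; apply/funext => t; rewrite scaleN1r addrC.
Qed.

Lemma WrepD n (y v z u : R -> 'cV[R]_n) : Wrep y v -> Wrep z u ->
  Wrep (fun t => y t + z t) (fun t => v t + u t).
Proof.
move=> yv zu; have := Wrep_lin 1 yv zu.
by congr Wrep; apply/funext => t; rewrite scale1r.
Qed.

Lemma vint0 n (t : R) : vint (fun=> 0 : 'cV[R]_n) 0 t = 0.
Proof.
apply/matrixP => i j; rewrite !mxE.
by rewrite Rintegral_cst// mul0r.
Qed.

Lemma Wrep0 n : Wrep (fun=> 0 : 'cV[R]_n) (fun=> 0).
Proof. by split => [||t _]; rewrite ?vint0 ?addr0//; exact: L2fun0. Qed.

Lemma Wnorm0 n : Wnorm (fun=> 0 : 'cV[R]_n) = 0.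
Proof.
apply/eqP; rewrite -sqrf_eq0 (sqr_Wnorm (Wrep0 n)) /L2sq /L2sqE.
under eq_integral do rewrite enorm0 expr0n/=.
by rewrite integral0 addr0.
Qed.

(** The indefinite integral is continuous on [[0, t + 1]], an interval with [t] strictly below its
    right end; at [t = 0] the continuity is one-sided. *)
Lemma Wrep_continuous n (y v : R -> 'cV[R]_n) t e : Wrep y v -> Itime R t -> 0 < e ->
  exists2 d : R, 0 < d & forall s, Itime R s -> `|s - t| < d -> enorm (y s - y t) <= e.
Proof.
move=> [Ly Lv yv] It e0; have t0 : 0 <= t by exact/Itime_ge0.
have n0 : 0 < (n%:R + 1 : R) by rewrite ltr_wpDl.
set e' := e / (n%:R + 1); have e'0 : 0 < e' by rewrite divr_gt0.
have H i : \forall s \near t, Itime R s -> `|y s i 0 - y t i 0| <= e'.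
  have t10 : 0 <= t + 1 by rewrite addr_ge0.
  have := parameterized_integral_continuous t10
    (L2fun_integrable_itv i (t + 1) true false (lexx 0) Lv).
  move/subspace_continuousP => /(_ t) /=.
  rewrite in_itv/= t0 lerDl ler01 => /(_ isT)/cvgrPdist_le/(_ _ e'0).
  rewrite near_withinE => Hc.
  have tt1 : t < t + 1 by rewrite ltrDl.
  apply: filterS2 Hc (lt_nbhsl tt1) => s Hs st Is.
  have sin : s \in `[0, t + 1] by rewrite in_itv/= (ltW st) andbT; exact/Itime_ge0.
  rewrite distrC (yv s Is) (yv t It) !mxE opprD addrACA subrr add0r.
  exact: Hs sin.
have : \forall s \near t, forall i, Itime R s -> `|y s i 0 - y t i 0| <= e'.
  exact: (@filter_forall _ _ (fun i s => Itime R s -> `|y s i 0 - y t i 0| <= e')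
    _ (nbhs_filter t) H).
move=> /nbhs_ballP[d /= d0 Hd]; exists d => // s Is st.
have := Hd s; rewrite /ball/= distrC => /(_ st) Hi.
rewrite (le_trans (enorm_le_coord (k:=e') _ _))//.
- exact: ltW.
- by move=> i; rewrite !mxE; exact: Hi.
- by rewrite /e' mulrCA ler_piMr ?(ltW e0)// ler_pdivrMr// mul1r lerDl.
Qed.

Definition cont_on n (K : set 'cV[R]_n) (G : 'cV[R]_n -> R) : Prop :=
  forall x, K x -> forall e : R, 0 < e -> exists2 d : R, 0 < d &
    forall z, K z -> enorm (z - x) < d -> `|G z - G x| <= e.

(** A trajectory is continuous on the half line, hence so is its composition with [G]. All
    coefficients and right-hand sides below get their measurability from here. *)
Lemma measurable_cont_on n (K : set 'cV[R]_n) G (y v : R -> 'cV[R]_n) :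
  Wrep y v -> (forall t, Itime R t -> K (y t)) -> cont_on K G ->
  measurable_fun (Itime R) (fun t => G (y t)).
Proof.
move=> yv Ky KG.
apply: (@subspace_continuous_measurable_fun R (Itime R) (fun t => G (y t))).
  exact: measurable_Itime.
apply/subspace_continuousP => t It; apply/cvgrPdist_le => /= e e0.
have [d d0 Hd] := KG _ (Ky _ It) _ e0.
have [d' d'0 Hd'] := Wrep_continuous yv It (divr_gt0 d0 (ltr0n _ 2)).
rewrite near_withinE; near=> s => Is; rewrite distrC.
apply: Hd; first exact: Ky.
rewrite (@le_lt_trans _ _ (d / 2))// ?ltr_pdivrMr ?ltr_pMr ?ltr1n//.
by apply: Hd' => //; rewrite distrC; near: s; exact: cvgr_dist_lt.
Unshelve. all: by end_near. Qed.

(** The density equals the right-hand side almost everywhere and may therefore be replaced by it: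
    the differential equation becomes an integral equation valid at every time. *)
Lemma solvesW_Wrep n g (y0 : 'cV[R]_n) y : solvesW g y0 y ->
  (forall i, measurable_fun (Itime R) (fun t => g t (y t) i 0)) ->
  Wrep y (fun t => g t (y t)) /\ y 0 = y0.
Proof.
move=> [/Winf_Wrep[v yv] [y00 yg]] mg; split => //.
have [Ly Lv yvt] := yv.
have gv : {ae mu, forall t, Itime R t -> g t (y t) = v t}.
  by apply: ae_imply2 yg (Wrep_ae yv) => t H1 H2 It; rewrite -H1// H2.
split => //; first by split => //; rewrite (L2sqE_ae Lv.1 gv); exact: Lv.2.
move=> t It; rewrite yvt//; congr (_ + _); apply/matrixP => i j; rewrite !mxE.
have sub : `[0, t] `<=` Itime R.
  by move=> s /=; rewrite in_itv/= => /andP[s0 _]; apply/Itime_ge0.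
congr fine; apply: ae_eq_integral => //.
- by apply/measurable_EFinP; apply: measurable_funS sub (Lv.1 i); exact: measurable_Itime.
- by apply/measurable_EFinP; apply: measurable_funS sub (mg i); exact: measurable_Itime.
- by apply: ae_imply gv => s H s0t; rewrite H//; exact: sub.
Qed.

Lemma Wrep_solvesW n g (y0 : 'cV[R]_n) y v : Wrep y v ->
  (forall t, Itime R t -> v t = g t (y t)) -> y 0 = y0 -> solvesW g y0 y.
Proof.
move=> yv vg y00; split; first exact: Wrep_Winf yv.
by split => //; apply: ae_imply (Wrep_ae yv) => t H It; rewrite H// vg.
Qed.

Lemma Wrep_sub_le n (y v : R -> 'cV[R]_n) (a t K : R) : Wrep y v ->
  0 <= K -> 0 <= a -> a <= t -> (forall s, a <= s <= t -> enorm (v s) <= K) ->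
  enorm (y t - y a) <= n%:R * (K * (t - a)).
Proof.
move=> [Ly Lv yv] K0 a0 at_ vK; apply: enorm_le_coord.
  by rewrite mulr_ge0// subr_ge0.
have It : Itime R t by apply/Itime_ge0; rewrite (le_trans a0).
have Ia : Itime R a by exact/Itime_ge0.
move=> i; have -> : (y t - y a) i 0 = vint v 0 t i 0 - vint v 0 a i 0.
  by rewrite (yv t It) (yv a Ia) !mxE; ring.
apply: vint_sub_le => // s ast.
by rewrite (le_trans (coord_le_enorm _ _))// vK.
Qed.

End Wspace.

(** * Perturbation of the closed-loop system *)

Section Geometric.
Variable R : realType.

Lemma geo_ge0 (c : R) k : 0 <= c -> 0 <= c / 2 ^+ k.
Proof. by move=> c0; rewrite divr_ge0// exprn_ge0. Qed.

Lemma geo_cvg0 (c : R) : (fun k => c / 2 ^+ k) @ \oo --> (0 : R).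
Proof.
rewrite -(mulr0 c); apply: cvgMr; under eq_fun do rewrite -exprVn.
by apply: cvg_expr; rewrite ger0_norm ?invr_ge0// invf_lt1// ltr1n.
Qed.

(** The form in which all limits are taken below: an inequality up to a geometric error holds
    exactly. *)
Lemma le_geo (x y c : R) : (forall k, x <= y + c / 2 ^+ k) -> x <= y.
Proof.
move=> H; have Hc : (fun k => y + c / 2 ^+ k) @ \oo --> y.
  by rewrite -[X in _ --> X]addr0; apply: cvgD; [exact: cvg_cst|exact: geo_cvg0].
rewrite -(cvg_lim _ Hc)//; apply: limr_ge; first by apply/cvg_ex; exists y.
by apply: nearW => k; exact: H.
Qed.

Lemma geo_cvg (u : nat -> R) l c : (forall k, `|u k - l| <= c / 2 ^+ k) ->
  u @ \oo --> l.
Proof.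
move=> H; apply/cvgrPdist_le => e e0.
have /cvgrPdist_le/(_ _ e0) := geo_cvg0 c; apply: filterS => k.
rewrite sub0r normrN => h; rewrite distrC (le_trans (H k))//.
by rewrite (le_trans (ler_norm _)).
Qed.

(** The intervals of centre [u k] and radius [g k], the tail of the geometric series, are nested;
    the limit is the supremum of their left ends. *)
Lemma geo_cauchy_lim (u : nat -> R) c : 0 <= c ->
  (forall k, `|u k.+1 - u k| <= c / 2 ^+ k) ->
  exists l, forall k, `|u k - l| <= 2 * c / 2 ^+ k.
Proof.
move=> c0 H.
pose g k := 2 * c / 2 ^+ k.
have gS k : g k = g k.+1 + c / 2 ^+ k.
  by rewrite /g exprS; field; rewrite expf_neq0.
have g0 k : 0 <= g k by rewrite geo_ge0// mulr_ge0.
have Hk k : u k - c / 2 ^+ k <= u k.+1 <= u k + c / 2 ^+ k.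
  by have := H k; rewrite ler_distl.
have lo k m : u k - g k <= u (k + m)%N - g (k + m)%N.
  elim: m => [|m IH]; first by rewrite addn0.
  rewrite addnS (le_trans IH)// gS; have /andP[] := Hk (k + m)%N; lra.
have hi k m : u (k + m)%N + g (k + m)%N <= u k + g k.
  elim: m => [|m IH]; first by rewrite addn0.
  rewrite addnS (le_trans _ IH)// (gS (k + m)%N); have /andP[] := Hk (k + m)%N; lra.
have cross k j : u k - g k <= u j + g j.
  have := lo k j; have := hi j k; rewrite addnC; have := g0 (j + k)%N.
  rewrite [(k + j)%N]addnC; lra.
exists (sup (range (fun k => u k - g k))) => k.
rewrite ler_distlC; apply/andP; split.
  apply: ub_le_sup; last by exists k.
  by exists (u 0%N + g 0%N) => _ [j _ <-]; exact: cross.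
apply: ge_sup; first by exists (u 0%N - g 0%N); exists 0%N.
by move=> _ [j _ <-]; exact: cross.
Qed.

Lemma geo_cauchy_lim_vec n (u : nat -> 'cV[R]_n) c : 0 <= c ->
  (forall k, enorm (u k.+1 - u k) <= c / 2 ^+ k) ->
  exists l, forall k, enorm (u k - l) <= n%:R * (2 * c) / 2 ^+ k.
Proof.
move=> c0 H.
have /choice[l Hl] : forall i, exists l, forall k, `|u k i 0 - l| <= 2 * c / 2 ^+ k.
  move=> i; apply: geo_cauchy_lim => // k.
  by rewrite (le_trans _ (H k))// (le_trans _ (coord_le_enorm _ i))// !mxE.
exists (\col_i l i) => k; rewrite -mulrA; apply: enorm_le_coord.
  by rewrite geo_ge0// mulr_ge0.
by move=> i; rewrite !mxE; exact: Hl.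
Qed.

End Geometric.

(** Self-mapping of the ball: the second hypothesis gives [2 * C * k * b <= b / 2], and half of the
    radius [4 * C * eta * N] remains for the source term. *)
Lemma absorb_step (R : realType) (C k eta N x b : R) :
  x <= C * (2 * (k * b + eta * N)) -> 4 * C * k * b <= 1 * b ->
  b <= 4 * C * eta * N -> x <= 4 * C * eta * N.
Proof. lra. Qed.

(** A priori bound: the term in [b] on the right is at most [b / 2] and moves to the left. *)
Lemma absorb_half (R : realType) (C k eta N b : R) :
  b <= C * (2 * (k * b + eta * N)) -> 4 * C * k * b <= 1 * b ->
  b <= 4 * C * eta * N.
Proof. lra. Qed.

Local Opaque Wnorm L2norm.

(** * Uniqueness and stability for a perturbed vector field *)

Section Core.
Variables (R : realType) (n : nat).
Variables (g0 g1 : 'cV[R]_n -> 'cV[R]_n) (A : 'cV[R]_n -> 'M[R]_n).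
Variables (Ci C L K eta r : R).
Hypotheses (Ci0 : 0 < Ci) (C0 : 0 < C) (L0 : 0 <= L) (K0 : 0 <= K) (eta0 : 0 <= eta).
Hypothesis emb : forall y : R -> 'cV[R]_n, Winf y ->
  forall t, Itime R t -> enorm (y t) <= Ci * Wnorm y.
Local Notation ball := (@cball0 R n r).
Hypothesis cg0 : forall i, cont_on ball (fun x => g0 x i 0).
Hypothesis cg1 : forall i, cont_on ball (fun x => g1 x i 0).
Hypothesis cA : forall i j, cont_on ball (fun x => A x i j).
Hypothesis lin1 : forall x a b, ball x -> ball a -> ball b ->
  enorm (g1 a - g1 b - A x *m (a - b)) <=
    (eta + L * (enorm (a - x) + enorm (b - x))) * enorm (a - b).
Hypothesis g10 : forall x, ball x -> enorm (g1 x - g0 x) <= eta * enorm x.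
Hypothesis Abd : forall x v, ball x -> enorm (A x *m v) <= K * enorm v.

Definition in_ball (y : R -> 'cV[R]_n) := forall t, Itime R t -> ball (y t).

(** Assumption 3 along a single trajectory, with [A] as the linearised closed loop. *)
Definition lin_solvable (ys : R -> 'cV[R]_n) : Prop :=
  forall dy0 dv, L2fun dv -> exists2 dy,
    solvesW (fun t x => A (ys t) *m x + dv t) dy0 dy &
    Wnorm dy <= C * (L2norm dv + enorm dy0) /\
    forall z, solvesW (fun t x => A (ys t) *m x + dv t) dy0 z -> eqI z dy.

(** Every [z] solves the linear problem whose source is its own residual; uniqueness identifies it
    with the solution that carries the estimate. *)
Lemma lin_solvable_est ys z u : lin_solvable ys -> Wrep z u ->
  L2fun (fun t => u t - A (ys t) *m z t) ->
  Wnorm z <= C * (L2norm (fun t => u t - A (ys t) *m z t) + enorm (z 0)).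
Proof.
move=> lys zu Lq; have [dy dys [Wdy uniq]] := lys (z 0) _ Lq.
have zdy : eqI z dy.
  by apply: uniq; apply: Wrep_solvesW zu _ _ => // t It; rewrite subrKC.
by rewrite -(Wnorm_eqI (Wrep_Winf zu) zdy).
Qed.

Lemma measurable_mulA ys vs (z : R -> 'cV[R]_n) : Wrep ys vs -> in_ball ys ->
  (forall i, measurable_fun (Itime R) (fun t => z t i 0)) ->
  forall i, measurable_fun (Itime R) (fun t => (A (ys t) *m z t) i 0).
Proof.
move=> ysv bys mz i; under eq_fun do rewrite mxE.
apply: measurable_sum => j; apply: measurable_funM => //.
exact: (measurable_cont_on ysv bys (cA i j)).
Qed.

Lemma measurable_cVB (y z : R -> 'cV[R]_n) :
  (forall i, measurable_fun (Itime R) (fun t => y t i 0)) ->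
  (forall i, measurable_fun (Itime R) (fun t => z t i 0)) ->
  forall i, measurable_fun (Itime R) (fun t => (y t - z t) i 0).
Proof.
move=> my mz i; have := measurable_lin (-1) mz my i.
by apply: eq_measurable_fun => t _; rewrite scaleN1r addrC.
Qed.

(** Linearise at [x = b] and use that two points of the ball are at most [2 * r] apart. *)
Lemma g1_lip a b : ball a -> ball b ->
  enorm (g1 a - g1 b) <= (K + eta + L * (2 * r)) * enorm (a - b).
Proof.
move=> ba bb; have := lin1 bb ba bb; rewrite subrr enorm0 addr0 => h.
have ab : enorm (a - b) <= 2 * r.
  by rewrite (le_trans (enormB _ _))// mulr2n mulrDl mul1r lerD.
rewrite -[g1 a - g1 b](subrK (A b *m (a - b))) (le_trans (enormD _ _))//.
have := Abd (a - b) bb.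
have : L * enorm (a - b) * enorm (a - b) <= L * (2 * r) * enorm (a - b).
  by rewrite ler_wpM2r ?enorm_ge0// ler_wpM2l.
lra.
Qed.

(* Gronwall: on a time interval of length less than 1/(2 n Lip(g1)) that starts where
   both solutions agree, each use of the integral equation halves the bound on their
   distance. *)
Lemma closed_loop_unique y z : Wrep y (fun t => g1 (y t)) -> Wrep z (fun t => g1 (z t)) ->
  in_ball y -> in_ball z -> y 0 = z 0 -> eqI y z.
Proof.
move=> yv zv byy bz yz0.
have [r0|r0] := ltP r 0.
  by move=> t It; have := le_lt_trans (byy t It) r0; rewrite ltNge enorm_ge0.
pose Kl := K + eta + L * (2 * r).
have Kl0 : 0 <= Kl by rewrite !addr_ge0// !mulr_ge0.
(* The summand [1] makes the window length [h] well defined when the Lipschitz constant vanishes. *)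
pose q : R := n%:R * Kl + 1.
have q0 : 0 < q by rewrite ltr_wpDl// mulr_ge0.
pose h := (2 * q)^-1; have h0 : 0 < h by rewrite invr_gt0 mulr_gt0.
pose D t := y t - z t.
have DW : Wrep D (fun t => g1 (y t) - g1 (z t)) := WrepB yv zv.
suff H k : forall t, 0 <= t <= k%:R * h -> D t = 0.
  move=> t /Itime_ge0 t0; apply/eqP; rewrite -subr_eq0; apply/eqP.
  have [k kt] : exists k : nat, t / h <= k%:R.
    by exists (Num.truncn (t / h)).+1; rewrite ltW// truncnS_gt.
  by apply: (H k); rewrite t0/= -ler_pdivrMr.
elim: k => [t|k IH t].
  by rewrite mul0r -eq_le => /eqP <-; rewrite /D yz0 subrr.
pose a := k%:R * h; have a0 : 0 <= a by rewrite mulr_ge0// ltW.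
have Da : D a = 0 by apply: IH; rewrite a0/=.
case/andP => t0 tk; have [ta|/ltW at_] := leP t a; first by apply: IH; rewrite t0.
have tah : t <= a + h by move: tk; rewrite -natr1 mulrDl mul1r.
(* The summand [0] gives the bound the shape required by [le_geo]; the induction starts from the
   diameter [2 * r] of the ball. *)
suff Hj j : forall s, a <= s <= a + h -> enorm (D s) <= 0 + 2 * r / 2 ^+ j.
  apply: enorm_le0; apply: (@le_geo _ _ _ (2 * r)) => j.
  by apply: Hj; rewrite at_.
elim: j => [s /andP[as_ sah]|j IHj s /andP[as_ sah]].
  rewrite expr0 divr1 add0r (le_trans (enormB _ _))// mulr2n mulrDl mul1r.
  by apply: lerD; [apply: byy|apply: bz]; apply/Itime_ge0/(le_trans a0).
have := @Wrep_sub_le _ _ _ _ a s (Kl * (2 * r / 2 ^+ j)) DW.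
rewrite Da subr0 add0r => /(_ _ a0 as_) H.
rewrite (le_trans (H _ _))//.
- by rewrite mulr_ge0// geo_ge0// mulr_ge0.
- move=> s' /andP[as' s's]; have Is' : Itime R s' by apply/Itime_ge0/(le_trans a0).
  rewrite (le_trans (g1_lip (byy _ Is') (bz _ Is')))// ler_wpM2l//.
  by have := IHj s'; rewrite add0r; apply; rewrite as' (le_trans s's).
- have G0 := geo_ge0 j (mulr_ge0 (ler0n R 2) r0).
  rewrite exprS invfM mulrCA [leRHS]mulrC; set G := 2 * r / 2 ^+ j in G0 *.
  have sh : s - a <= h by rewrite lerBlDl.
  have : n%:R * Kl * (s - a) <= 2^-1.
    rewrite (@le_trans _ _ (q * h))//.
      by apply: ler_pM; rewrite ?mulr_ge0 ?subr_ge0// lerDl.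
    by rewrite /h invfM mulrCA divff ?mulr1// gt_eqF.
  move=> /(ler_wpM2r G0); rewrite /G; lra.
Qed.

(** The difference of the two solutions satisfies the linear equation along [ys] with a residual at
    most [eta + L * d] times itself; smallness absorbs half of its norm. The three trajectories may
    start at different points. *)
Lemma solution_dist ys vs y z d : lin_solvable ys -> Wrep ys vs -> in_ball ys ->
  Wrep y (fun t => g1 (y t)) -> Wrep z (fun t => g1 (z t)) ->
  in_ball y -> in_ball z ->
  (forall t, Itime R t -> enorm (y t - ys t) + enorm (z t - ys t) <= d) ->
  0 <= d -> 2 * C * (eta + L * d) <= 1 ->
  Wnorm (fun t => y t - z t) <= 2 * C * enorm (y 0 - z 0).
Proof.
move=> lys ysv bys yv zv byy bz yzd d0 small.
have [Ly Lyv _] := yv; have [Lz Lzv _] := zv.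
have DW := WrepB yv zv; have [LD LDv _] := DW.
have k0 : 0 <= eta + L * d by rewrite addr_ge0// mulr_ge0.
have mq := measurable_cVB LDv.1 (measurable_mulA ysv bys LD.1).
have [t It|Lq qle] := L2norm_le1 LD k0 mq.
  rewrite (le_trans (lin1 (bys t It) (byy t It) (bz t It)))//.
  by rewrite ler_wpM2r ?enorm_ge0// lerD2l ler_wpM2l// yzd.
have := lin_solvable_est lys DW Lq.
set W := Wnorm _; set Q := L2norm _ in qle *; set e := enorm _ => est.
have qW : Q <= (eta + L * d) * W.
  by rewrite (le_trans qle)// ler_wpM2l// L2norm_le_Wnorm.
have : C * Q <= C * ((eta + L * d) * W) by rewrite ler_pM2l.
have : 2 * C * (eta + L * d) * W <= 1 * W by rewrite ler_wpM2r// Wnorm_ge0.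
lra.
Qed.

(** * Picard iteration for the deviation from the reference trajectory *)

Section Existence.
Variables (ys : R -> 'cV[R]_n) (N : R).
Hypothesis ysv : Wrep ys (fun t => g0 (ys t)).
Hypothesis lys : lin_solvable ys.
Hypothesis ysN : Wnorm ys <= N.
(** [rho] is the radius of the ball of deviations and [kappa] the Lipschitz constant of the
    remainder [dv] on it: two deviations bounded by [Ci * rho] make the bracket in [lin1] at most
    [kappa]. *)
Let rho := 4 * C * eta * N.
Let kappa := eta + L * (2 * (Ci * rho)).
Hypothesis ysr : forall t, Itime R t -> enorm (ys t) + Ci * rho <= r.
Hypothesis small : 4 * C * kappa <= 1.

Let N0 : 0 <= N. Proof. exact: le_trans (Wnorm_ge0 _) ysN. Qed.
Let rho0 : 0 <= rho. Proof. by rewrite !mulr_ge0// ltW. Qed.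
Let kappa0 : 0 <= kappa. Proof. by rewrite addr_ge0// !mulr_ge0// ltW. Qed.
Let c0 : 0 <= Ci * rho. Proof. by rewrite mulr_ge0// ltW. Qed.

Let dv (w : R -> 'cV[R]_n) t := g1 (ys t + w t) - g0 (ys t) - A (ys t) *m w t.

(** The iterates are controlled by [good], in the norm of W_infty. The weaker [tiny] passes to
    pointwise limits, so it is available before the limit is known to lie in W_infty. *)
Let tiny (w : R -> 'cV[R]_n) := forall t, Itime R t -> enorm (w t) <= Ci * rho.

Let good (w : R -> 'cV[R]_n) := [/\ Winf w, w 0 = 0 & Wnorm w <= rho].

Let good_tiny w : good w -> tiny w.
Proof.
move=> [Ww _ wr] t It; by rewrite (le_trans (emb Ww It))// ler_wpM2l// ltW.
Qed.

Let bys : in_ball ys.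
Proof. by move=> t It; have := ysr It; rewrite /cball0/=; move: c0; lra. Qed.

Let bysw w : tiny w -> in_ball (fun t => ys t + w t).
Proof.
move=> tw t It; rewrite /cball0/= (le_trans (enormD _ _))//.
by rewrite (le_trans _ (ysr It))// lerD2l tw.
Qed.

Let g1_diff w1 w2 t : tiny w1 -> tiny w2 -> Itime R t ->
  enorm (g1 (ys t + w1 t) - g1 (ys t + w2 t) - A (ys t) *m (w1 t - w2 t))
    <= kappa * enorm (w1 t - w2 t).
Proof.
move=> t1 t2 It; have := lin1 (bys It) (bysw t1 It) (bysw t2 It).
have -> : ys t + w1 t - (ys t + w2 t) = w1 t - w2 t.
  by rewrite opprD addrACA subrr add0r.
have E w : ys t + w t - ys t = w t by rewrite addrC addKr.
rewrite !E => h; rewrite (le_trans h)// ler_wpM2r ?enorm_ge0// lerD2l ler_wpM2l//.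
by rewrite mulr2n mulrDl mul1r lerD ?t1 ?t2.
Qed.

Let dv_diff w1 w2 t : tiny w1 -> tiny w2 -> Itime R t ->
  enorm (dv w1 t - dv w2 t) <= kappa * enorm (w1 t - w2 t).
Proof.
move=> t1 t2 It; rewrite (le_trans _ (g1_diff t1 t2 It))//.
rewrite le_eqVlt; apply/orP; left; apply/eqP; congr enorm; rewrite /dv mulmxBr.
move: (g1 _) (g1 _) (g0 _) (_ *m _) (_ *m _) => a b c d e.
by apply/matrixP => i j; rewrite !mxE; ring.
Qed.

(** Compare with the zero deviation, whose remainder [g1 - g0] along [ys] is bounded by [g10]. *)
Let dv_le w t : tiny w -> Itime R t ->
  enorm (dv w t) <= kappa * enorm (w t) + eta * enorm (ys t).
Proof.
move=> tw It.
have t0 : tiny (fun=> 0) by move=> s _; rewrite enorm0.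
have := dv_diff tw t0 It; rewrite subr0 => h.
rewrite -[dv w t](subrK (dv (fun=> 0) t)) (le_trans (enormD _ _))// lerD//.
by rewrite /dv addr0 mulmx0 subr0 g10//; exact: bys.
Qed.

Let Wysw w u : Wrep w u -> Wrep (fun t => ys t + w t) (fun t => g0 (ys t) + u t).
Proof. exact: WrepD. Qed.

Let dv_measurable w u : Wrep w u -> tiny w ->
  forall i, measurable_fun (Itime R) (fun t => dv w t i 0).
Proof.
move=> wu tw; have [Lw _ _] := wu.
apply: measurable_cVB; last exact: measurable_mulA ysv bys Lw.1.
apply: measurable_cVB => i.
  exact: (measurable_cont_on (Wysw wu) (bysw tw) (cg1 i)).
exact: (measurable_cont_on ysv bys (cg0 i)).
Qed.

Let dv_L2 w u : Wrep w u -> tiny w ->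
  L2fun (dv w) /\ L2norm (dv w) <= 2 * (kappa * Wnorm w + eta * N).
Proof.
move=> wu tw; have [Lw _ _] := wu; have [Lys _ _] := ysv.
have [t It|Ld h] := L2norm_le2 Lw Lys kappa0 eta0 (dv_measurable wu tw).
  exact: dv_le.
split => //; rewrite (le_trans h)// ler_pM2l// lerD//.
  by rewrite ler_wpM2l// L2norm_le_Wnorm.
by rewrite ler_wpM2l// (le_trans (L2norm_le_Wnorm _)).
Qed.

Let vk (w w' : R -> 'cV[R]_n) t := A (ys t) *m w' t + dv w t.

(** One Picard step: the remainder at [w] is the source of the linear problem with zero initial
    value, and [absorb_step] keeps the solution in the ball. *)
Let step w : good w -> exists w', good w' /\ Wrep w' (vk w w').
Proof.
move=> gw; have tw := good_tiny gw; have [/Winf_Wrep[u wu] w0 wrho] := gw.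
have [Ld dle] := dv_L2 wu tw.
have [w' sw' [Ww' _]] := lys 0 Ld.
have [/Winf_Wrep[u' [Lw' _ _]] _] := sw'.
have [|w'W w'0] := solvesW_Wrep sw'.
  move=> i; have := measurable_lin 1 (measurable_mulA ysv bys Lw'.1) Ld.1 i.
  by apply: eq_measurable_fun => t _; rewrite scale1r.
exists w'; split; last exact: w'W.
split; [exact: Wrep_Winf w'W|exact: w'0|].
rewrite (le_trans Ww')// enorm0 addr0.
have h1 : C * L2norm (dv w) <= C * (2 * (kappa * rho + eta * N)).
  rewrite ler_pM2l// (le_trans dle)// ler_pM2l// lerD2r ler_wpM2l//.
have h2 : 4 * C * kappa * rho <= 1 * rho by rewrite ler_wpM2r.
exact: absorb_step h1 h2 (lexx _).
Qed.

(** The iterates and their densities converge pointwise at a geometric rate uniform in time, which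
    lets the integral equation pass to the limit. *)
Lemma perturbed_solution : exists w,
  [/\ Wrep w (fun t => g1 (ys t + w t) - g0 (ys t)), w 0 = 0 & Wnorm w <= rho].
Proof.
(* Off the good deviations the step is totalised by the identity. *)
have /choice[S HS] : forall w, exists w', good w -> good w' /\ Wrep w' (vk w w').
  move=> w; have [/step[w' ?]|ngw] := pselect (good w); first by exists w'.
  by exists w.
pose W k := iter k S (fun=> 0 : 'cV[R]_n).
have gW k : good (W k).
  elim: k => [|k IH]; last exact: (HS _ IH).1.
  by split => //; [exact: Wrep_Winf (@Wrep0 R n)|rewrite Wnorm0].
have WS k : Wrep (W k.+1) (vk (W k) (W k.+1)) := (HS _ (gW k)).2.
have tW k := good_tiny (gW k).
(* [A] cancels from the residual of the difference, leaving the increment of [dv];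
   [4 * C * kappa <= 1] then gives a factor below one half. *)
have contr k : Wnorm (fun t => W k.+2 t - W k.+1 t) <=
    Wnorm (fun t => W k.+1 t - W k t) / 2.
  have DW := WrepB (WS k.+1) (WS k).
  have [/Winf_Wrep[u1 W1] _ _] := gW k.+1; have [/Winf_Wrep[u0 W0] _ _] := gW k.
  have [LD _ _] := WrepB W1 W0.
  have E t : vk (W k.+1) (W k.+2) t - vk (W k) (W k.+1) t -
      A (ys t) *m (W k.+2 t - W k.+1 t) = dv (W k.+1) t - dv (W k) t.
    rewrite /vk mulmxBr; move: (_ *m _) (_ *m _) (dv _ _) (dv _ _) => a b c d.
    by apply/matrixP => i j; rewrite !mxE; ring.
  have mq := measurable_cVB (dv_measurable W1 (tW k.+1)) (dv_measurable W0 (tW k)).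
  have [t It|Lq qle] := L2norm_le1 LD kappa0 mq; first exact: dv_diff.
  have := lin_solvable_est lys DW; under eq_fun do rewrite E.
  move=> /(_ Lq); have [_ -> _] := gW k.+2; have [_ -> _] := gW k.+1.
  rewrite subrr enorm0 addr0 => h; rewrite (le_trans h)//.
  have := L2norm_le_Wnorm (fun t => W k.+1 t - W k t).
  set a := L2norm _ in qle *; set b := L2norm _ in qle *; set w := Wnorm _ => bw.
  have : C * a <= C * (kappa * w).
    by rewrite ler_pM2l// (le_trans qle)// ler_wpM2l.
  have : 4 * C * kappa * w <= 1 * w by rewrite ler_wpM2r// Wnorm_ge0.
  have : 0 <= w by exact: Wnorm_ge0.
  lra.
have geo k : Wnorm (fun t => W k.+1 t - W k t) <= rho / 2 ^+ k.
  elim: k => [|k IH].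
    rewrite expr0 divr1; have -> : (fun t => W 1%N t - W 0%N t) = W 1%N.
      by apply/funext => t; rewrite subr0.
    by have [] := gW 1%N.
  rewrite (le_trans (contr k))// exprS invfM mulrCA mulrC ler_wpM2l ?invr_ge0//.
have geot t k : Itime R t -> enorm (W k.+1 t - W k t) <= Ci * rho / 2 ^+ k.
  move=> It; have WW : Winf (fun t => W k.+1 t - W k t).
    have [/Winf_Wrep[u0 W0] _ _] := gW k.
    exact: Wrep_Winf (WrepB (WS k) W0).
  by rewrite (le_trans (emb WW It))// -mulrA ler_wpM2l// ltW.
(* The 2 is the sum of the geometric series, and [n] comes from passing from coordinates to the
   Euclidean norm. *)
pose c1 := n%:R * (2 * (Ci * rho)).
have c10 : 0 <= c1 by exact: mulr_ge0 (ler0n _ _) (mulr_ge0 (ler0n _ 2) c0).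
have /choice[w Hw] : forall t, exists l, Itime R t ->
    forall k, enorm (W k t - l) <= c1 / 2 ^+ k.
  move=> t; have [It|] := pselect (Itime R t); last by exists 0.
  have [l Hl] := @geo_cauchy_lim_vec R n (W^~ t) _ c0 (fun k => geot t k It).
  by exists l.
have w0 : w 0 = 0.
  have I0 : Itime R 0 by apply/Itime_ge0.
  apply: enorm_le0; apply: (@le_geo _ _ _ c1) => k.
  by have := Hw _ I0 k; have [_ -> _] := gW k; rewrite sub0r enormN add0r.
have tw : tiny w.
  move=> t It; apply: (@le_geo _ _ _ c1) => k.
  rewrite -[w t](subKr (W k t)) (le_trans (enormB _ _))// lerD ?Hw//.
  exact: tW.
pose v t := g1 (ys t + w t) - g0 (ys t).
(* The first term bounds the gap between consecutive iterates under [A]; the second bounds the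
   distance to the limit under [A] and under the remainder. *)
pose c2 := K * (Ci * rho) + (K + kappa) * c1.
have c20 : 0 <= c2 by exact: addr_ge0 (mulr_ge0 K0 c0) (mulr_ge0 (addr_ge0 K0 kappa0) c10).
have Hv t k : Itime R t -> enorm (vk (W k) (W k.+1) t - v t) <= c2 / 2 ^+ k.
  move=> It.
  have -> : vk (W k) (W k.+1) t - v t = A (ys t) *m (W k.+1 t - W k t) +
     ((g1 (ys t + W k t) - g1 (ys t + w t) - A (ys t) *m (W k t - w t)) +
      A (ys t) *m (W k t - w t)).
    rewrite subrK mulmxBr /vk /dv /v.
    move: (_ *m _) (_ *m _) (g1 _) (g1 _) (g0 _) => a b c d e.
    by apply/matrixP => i j; rewrite !mxE; ring.
  have h1 := Abd (W k.+1 t - W k t) (bys It).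
  have h2 := Abd (W k t - w t) (bys It).
  have h3 := g1_diff (tW k) tw It.
  have h4 : K * enorm (W k.+1 t - W k t) <= K * (Ci * rho / 2 ^+ k).
    by rewrite ler_wpM2l// geot.
  have h5 : K * enorm (W k t - w t) <= K * (c1 / 2 ^+ k) by rewrite ler_wpM2l// Hw.
  have h6 : kappa * enorm (W k t - w t) <= kappa * (c1 / 2 ^+ k).
    by rewrite ler_wpM2l// Hw.
  rewrite (le_trans (enormD _ _))// (le_trans (lerD h1 (enormD _ _)))//.
  rewrite (le_trans (lerD h4 (lerD (le_trans h3 h6) (le_trans h2 h5))))//.
  have sumE (a b c d g : R) :
      a * (b / g) + (d * (c / g) + a * (c / g)) = (a * b + (a + d) * c) / g by ring.
  by rewrite sumE.
have mw i : measurable_fun (Itime R) (fun t => w t i 0).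
  apply: (@measurable_fun_cvg _ _ _ _ (fun k t => W k t i 0)).
    by move=> k; have [/Winf_Wrep[u [Lu _ _]] _ _] := gW k; exact: Lu.1.
  move=> t It; apply: (@geo_cvg _ _ _ c1) => k.
  by rewrite (le_trans _ (Hw t It k))// (le_trans _ (coord_le_enorm _ i))// !mxE.
have mv i : measurable_fun (Itime R) (fun t => v t i 0).
  apply: (@measurable_fun_cvg _ _ _ _ (fun k t => vk (W k) (W k.+1) t i 0)).
    by move=> k; have [_ Lu _] := WS k; exact: Lu.1.
  move=> t It; apply: (@geo_cvg _ _ _ c2) => k.
  by rewrite (le_trans _ (Hv t k It))// (le_trans _ (coord_le_enorm _ i))// !mxE.
(* Fatou's lemma: the squared norms of the iterates are all at most [rho ^+ 2]. *)
have Lw : L2fun w.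
  split => //; apply: (@le_lt_trans _ _ (rho ^+ 2)%:E); last exact: ltry.
  pose f k t := (enorm (W k t) ^+ 2)%:E.
  have fw t : Itime R t -> limn_einf (f^~ t) = (enorm (w t) ^+ 2)%:E.
    move=> It; apply: (@cvg_limn_einf_sup R (f^~ t) _ _).1.
    apply: cvg_EFin; first exact: nearW.
    rewrite expr2 (_ : fine \o f^~ t = (fun k => enorm (W k t) * enorm (W k t))).
      2: by apply/funext => k; rewrite /f /= expr2.
    have ew : enorm (W k t) @[k --> \oo] --> enorm (w t).
      apply: (@geo_cvg _ _ _ c1) => k; rewrite (le_trans _ (Hw t It k))//.
      rewrite ler_norml; apply/andP; split.
        rewrite lerNl opprB lerBlDr enormBC (le_trans _ (enormD _ _))//.
        by rewrite subrK.
      by rewrite lerBlDr (le_trans _ (enormD _ _))// subrK.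
    exact: cvgM.
  have -> : L2sqE w = (\int[leb R]_(t in Itime R) limn_einf (f^~ t))%E.
    by apply: eq_integral => t /set_mem It; rewrite fw.
  apply: le_trans (fatou _ _ _ _) _.
  - exact: measurable_Itime.
  - move=> k; have [/Winf_Wrep[u [Lu _ _]] _ _] := gW k.
    exact: measurable_sqr_enorm Lu.1.
  - by move=> k t _; rewrite lee_fin sqr_ge0.
  rewrite limn_einf_lim; apply: lime_le; first exact: is_cvg_einfs.
  apply: nearW => k; apply: (@le_trans _ _ (L2sqE (W k))).
    by apply: ereal_inf_lbound; exists k => /=.
  have [/Winf_Wrep[u Wu] _ Wr] := gW k; have [Lu _ _] := Wu.
  rewrite L2sqEE// lee_fin (@le_trans _ _ (Wnorm (W k) ^+ 2))//.
    by rewrite (sqr_Wnorm Wu) lerDl L2sq_ge0.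
  by rewrite lerXn2r ?nnegrE ?Wnorm_ge0.
have Lv : L2fun v.
  have [Lys _ _] := ysv.
  have Kk0 : 0 <= K + kappa by rewrite addr_ge0.
  have [t It|//] := L2norm_le2 Lw Lys Kk0 eta0 mv.
  have -> : v t = dv w t + A (ys t) *m w t by rewrite /dv subrK.
  rewrite (le_trans (enormD _ _))//; have := dv_le tw It; have := Abd (w t) (bys It).
  lra.
(* Compare [w] with the iterate of index [k.+1], and that iterate with the integral of [v]; both
   errors are geometric in [k]. *)
have Ww : Wrep w v.
  split => // t It; rewrite w0 add0r.
  suff h : enorm (w t - vint v 0 t) <= 0.
    by apply/eqP; rewrite -subr_eq0; apply/eqP; exact: enorm_le0.
  have t0 : 0 <= t by exact/Itime_ge0.
  apply: (@le_geo _ _ _ (c1 + n%:R * (c2 * t))) => k; rewrite add0r.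
  have [_ Lvk Wt] := WS k.
  have LB : L2fun (fun t => -1 *: v t + vk (W k) (W k.+1) t) by exact: L2fun_lin.
  have vd : enorm (W k.+1 t - vint v 0 t) <= n%:R * (c2 / 2 ^+ k * t).
    apply: enorm_le_coord => [|i]; first by rewrite mulr_ge0// geo_ge0.
    have -> : W k.+1 t - vint v 0 t =
        vint (fun t => -1 *: v t + vk (W k) (W k.+1) t) 0 t.
      by rewrite vint_lin// Wt//; have [_ -> _] := gW k.+1; rewrite add0r scaleN1r addrC.
    have := @vint_sub_le _ _ _ i 0 t (c2 / 2 ^+ k) LB (lexx 0) t0.
    rewrite subr0 [X in _ - X](_ : _ = 0); last first.
      by rewrite mxE set_itv1 Rintegral_set1.
    rewrite subr0; apply => s /andP[s0 _]; have Is : Itime R s by exact/Itime_ge0.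
    rewrite (le_trans (coord_le_enorm _ _))// scaleN1r addrC; exact: Hv.
  have wd := Hw t It k.+1.
  rewrite -[w t - _](subrKA (W k.+1 t)) (le_trans (enormD _ _))//.
  rewrite enormBC mulrDl lerD//; last by rewrite (le_trans vd)// !mulrA mulrAC -!mulrA.
  rewrite (le_trans wd)// ler_wpM2l// lef_pV2 ?posrE ?exprn_gt0// exprS.
  by rewrite ler_peMl ?exprn_ge0// ler1n.
(* Fatou controlled only the L2 norm. The bound in W_infty comes from the linear estimate applied to
   [w] itself, with source [dv w], and [absorb_half]. *)
exists w; split => //.
have [Ld dle] := dv_L2 Ww tw.
have E : (fun t => v t - A (ys t) *m w t) = dv w by [].
have := lin_solvable_est lys Ww; rewrite E => /(_ Ld); rewrite w0 enorm0 addr0.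
set a := L2norm _ in dle *; set b := Wnorm _ in dle * => h.
have h1 : C * a <= C * (2 * (kappa * b + eta * N)) by rewrite ler_pM2l.
have h2 : 4 * C * kappa * b <= 1 * b by rewrite ler_wpM2r// Wnorm_ge0.
exact: absorb_half (le_trans h h1) h2.
Qed.

End Existence.
End Core.

(** * Dependence on the initial state *)

Section Topology.
Variable R : realType.

Lemma coord_le_normr n (y : 'cV[R]_n) i : `|y i 0| <= `|y|.
Proof.
rewrite [leRHS]mx_normrE.
exact: (le_bigmax _ (fun ij : 'I_n * 'I_1 => `|y ij.1 ij.2|) (i, 0)).
Qed.

Lemma compact_enorm_bounded n (Y : set 'cV[R]_n) : compact Y ->
  has_ubound [set enorm y | y in Y].
Proof.
move=> /compact_bounded[k [kr Hk]].
have k1 : k < `|k| + 1 by rewrite ltr_pwDr// ler_norm.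
exists (n%:R * (`|k| + 1)) => _ [y Yy <-]; apply: enorm_le_coord.
  by rewrite addr_ge0.
by move=> i; rewrite (le_trans _ (Hk _ k1 y Yy))// coord_le_normr.
Qed.

(** (A.1) gives Lipschitz constants on compact sets, so the Euclidean ball is enclosed in a cube.
    The cube is built from row vectors, as a product of segments, and transposed. *)
Lemma cball0_subset_compact n (r : R) : exists2 K : set 'cV[R]_n,
  compact K & cball0 r `<=` K.
Proof.
pose K' := [set v : 'rV[R]_n | forall i, `[- r, r]%classic (v ord0 i)].
have cK' : compact K' by exact: (@rV_compact _ _ (fun=> `[- r, r]%classic)
    (fun=> @segment_compact _ _ _)).
exists (trmx @` K').
  apply: continuous_compact cK'; apply: continuous_subspaceT => M N [P HP sub].
  exists (fun i j => P j i) => [i j|Q HQ]; first by have := HP j i; rewrite mxE.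
  by apply: sub => i j; rewrite mxE; exact: HQ.
move=> x xr; exists x^T; last by rewrite trmxK.
move=> i /=; rewrite in_itv/= mxE -ler_norml.
exact: le_trans (coord_le_enorm _ _) xr.
Qed.

End Topology.

Section Dependence.
Variables (R : realType) (n : nat) (Ci : R).
Hypothesis Ci0 : 0 < Ci.
Hypothesis emb : forall y : R -> 'cV[R]_n, Winf y ->
  forall t, Itime R t -> enorm (y t) <= Ci * Wnorm y.

Lemma WinfB (y z : R -> 'cV[R]_n) : Winf y -> Winf z -> Winf (fun t => y t - z t).
Proof.
by move=> /Winf_Wrep[u yu] /Winf_Wrep[v zv]; exact: Wrep_Winf (WrepB yu zv).
Qed.

(** [C1FrechetW] records the linearity of the derivative; its boundedness follows by expanding [h]
    in the standard basis. *)
Lemma linear_Winf_bounded (T : 'cV[R]_n -> R -> 'cV[R]_n) :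
  (forall h, Winf (T h)) ->
  (forall (a : R) h k, eqI (T (a *: h + k)) (fun t => a *: T h t + T k t)) ->
  exists2 K, 0 <= K & forall h t, Itime R t -> enorm (T h t) <= K * enorm h.
Proof.
move=> WT linT.
pose e i : 'cV[R]_n := delta_mx i 0.
exists (\sum_i Ci * Wnorm (T (e i))).
  by rewrite sumr_ge0// => i _; rewrite mulr_ge0 ?Wnorm_ge0// ltW.
move=> h t It.
(* Linearity with [a = -1] at zero vectors reads [T 0 t = - T 0 t + T 0 t]. *)
have T0 : T 0 t = 0.
  have := linT (-1) 0 0 t It; rewrite scaleN1r oppr0 add0r => ->.
  by rewrite scaleN1r addNr.
have hE : h = \sum_i h i 0 *: e i.
  apply/matrixP => i j; rewrite (ord1 j) summxE (bigD1 i)//= big1 ?addr0.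
    by rewrite !mxE !eqxx mulr1.
  by move=> k ki; rewrite !mxE eq_sym (negbTE ki) mulr0.
rewrite {1}hE; elim: (index_enum _) => [|i s IH].
  by rewrite !big_nil T0 enorm0 mul0r.
rewrite !big_cons (linT _ _ _ t It) (le_trans (enormD _ _))// mulrDl lerD//.
rewrite enormZ mulrC ler_pM ?enorm_ge0//; first exact: emb.
exact: coord_le_enorm.
Qed.

(** Differentiability implies continuity, uniformly in time by the embedding: the remainder costs
    [Ci * enorm h] and the derivative [K * enorm h]. *)
Lemma C1FrechetW_continuous (Nb : set 'cV[R]_n) ystar y0 : C1FrechetW Nb ystar ->
  (forall y, Nb y -> Winf (ystar y)) -> Nb y0 ->
  forall e : R, 0 < e -> exists2 d : R, 0 < d & forall y1, Nb y1 ->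
    enorm (y1 - y0) < d -> forall t, Itime R t ->
      enorm (ystar y1 t - ystar y0 t) <= e.
Proof.
move=> [Dy [WD [linD [HD _]]]] Wy Nb0 e e0.
have [K K0 HK] := linear_Winf_bounded (WD _ Nb0) (linD _ Nb0).
have [d d0 Hd] := HD _ Nb0 1 ltr01.
have CK : 0 < Ci + K by rewrite ltr_pwDl.
exists (Num.min d (e / (Ci + K))); first by rewrite lt_min d0 divr_gt0.
move=> y1 Nb1; rewrite lt_min ltr_pdivlMr// => /andP[hd he] t It.
have y1E : y0 + (y1 - y0) = y1 by rewrite subrKC.
have := Hd (y1 - y0) hd; rewrite y1E => /(_ Nb1); rewrite mul1r => Hw.
have WW := WinfB (WinfB (Wy _ Nb1) (Wy _ Nb0)) (WD _ Nb0 (y1 - y0)).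
have h1 := emb WW It; have h2 := HK (y1 - y0) t It.
rewrite -[X in enorm X](subrK (Dy y0 (y1 - y0) t)) (le_trans (enormD _ _))//.
have h3 := ler_wpM2l (ltW Ci0) Hw.
lra.
Qed.

End Dependence.

(** * Strong measurability of continuous maps on a compact set *)

Section Measurability.
Variables (R : realType) (n : nat) (d : measure_display) (T : measurableType d).
Variable iota : T -> 'cV[R]_n.
Hypothesis Hborel : forall O : set 'cV[R]_n, open O -> measurable (iota @^-1` O).

(** Choosing the first open set that contains the point makes a cover disjoint; each piece is one
    open set minus the earlier ones. *)
Lemma measurable_find (O : 'cV[R]_n -> set 'cV[R]_n) s j :
  (forall p, open (O p)) ->
  measurable [set x | find (fun p => `[< O p (iota x) >]) s = j].
Proof.
move=> oO; elim: s j => [|p s IH] [|j] /=.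
- by rewrite (_ : [set _ | _] = setT)//; apply/seteqP; split.
- by rewrite (_ : [set _ | _] = set0)//; apply/seteqP; split.
- rewrite (_ : [set _ | _] = iota @^-1` O p); first exact: Hborel.
  by apply/seteqP; split => x /=; case: asboolP.
- rewrite (_ : [set _ | _] = ~` (iota @^-1` O p) `&`
      [set x | find (fun p => `[< O p (iota x) >]) s = j]).
    by apply: measurableI (IH j); apply: measurableC; exact: Hborel.
  apply/seteqP; split => x /=; case: asboolP => Op.
  + by [].
  + by move=> [->].
  + by case.
  + by case=> _ ->.
Qed.

(** A finite subcover by balls, with the first ball that contains the point selecting the centre.
    The balls are those of the maximum norm, whence the factor [n]. *)
Lemma compact_measurable_net (Y : set 'cV[R]_n) (e : R) : compact Y -> Y 0 -> 0 < e ->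
  (forall x, Y (iota x)) ->
  exists N (p : 'I_N -> 'cV[R]_n) (idx : T -> 'I_N),
    [/\ forall j, Y (p j), forall j, measurable (idx @^-1` [set j]) &
        forall x, enorm (p (idx x) - iota x) <= n%:R * e].
Proof.
move=> cY Y0 e0 Yi.
pose O (p : 'cV[R]_n) := (ball p e)°.
have oO p : open (O p) by exact: open_interior.
have := cY; rewrite compact_cover => /(_ _ Y O (fun p _ => oO p)).
case=> [y Yy|D' D'Y covD'].
  by exists y => //; apply: nbhs_singleton; apply: nbhs_interior; exact: nbhsx_ballx.
pose s : seq 'cV[R]_n := finmap.enum_fset D'.
pose fnd x := find (fun p => `[< O p (iota x) >]) s.
have fndlt x : (fnd x < size s)%N.
  rewrite -has_find; have [p /= pD' Op] := covD' _ (Yi x).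
  by apply/hasP; exists p => //; exact/asboolP.
(* The extra index makes the ordinal type nonempty for [inord]; it is never selected, and its centre
   is the default 0, which lies in [Y]. *)
exists (size s).+1, (fun j => nth 0 s j), (fun x => inord (fnd x)); split.
- move=> j; have [js|js] := ltnP j (size s); last by rewrite nth_default.
  by have := D'Y _ (mem_nth 0 js); rewrite inE.
- move=> j; rewrite (_ : _ @^-1` _ = [set x | fnd x = j]); first exact: measurable_find.
  apply/seteqP; split => x /=.
    by move=> <-; rewrite inordK// ltnS ltnW.
  by move=> fj; apply/val_inj; rewrite /= inordK// ltnS ltnW.
- move=> x; rewrite inordK ?ltnS; last by rewrite ltnW.
  have /(nth_find 0) : has (fun p => `[< O p (iota x) >]) s.
    by rewrite has_find; exact: fndlt.
  move=> /asboolP /interior_subset Hb; apply: enorm_le_coord; first exact: ltW.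
  move: Hb; rewrite mx_norm_ball /ball_/= => Hb i.
  exact: le_trans (coord_le_normr _ i) (ltW Hb).
Qed.

(** Evaluating [g] at the centres of nets of radius of order [2^-k] gives simple functions, which
    converge at every point by continuity there. *)
Lemma strongly_measurableW_continuous (mu : {measure set T -> \bar R})
    (Y : set 'cV[R]_n) (g : 'cV[R]_n -> R -> 'cV[R]_n) :
  compact Y -> Y 0 -> (forall x, Y (iota x)) -> (forall y, Y y -> Winf (g y)) ->
  (forall y, Y y -> forall e : R, 0 < e -> exists2 dl : R, 0 < dl & forall z, Y z ->
     enorm (z - y) < dl -> Wnorm (fun t => g z t - g y t) <= e) ->
  strongly_measurableW mu (fun x => g (iota x)).
Proof.
move=> cY Y0 Yi Wg cg.
have /choice[N HN] : forall k : nat, exists N, exists (p : 'I_N -> 'cV[R]_n) (idx : T -> 'I_N),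
    [/\ forall j, Y (p j), forall j, measurable (idx @^-1` [set j]) &
        forall x, enorm (p (idx x) - iota x) <= n%:R * (1 / 2 ^+ k)].
  by move=> k; apply: compact_measurable_net => //; rewrite divr_gt0// exprn_gt0.
have /choice[s Hs] : forall k : nat, exists s : T -> 'cV[R]_n,
    (exists N (p : 'I_N -> 'cV[R]_n) (idx : T -> 'I_N),
      [/\ forall j, Y (p j), forall j, measurable (idx @^-1` [set j]) &
          forall x, s x = p (idx x)]) /\
    forall x, enorm (s x - iota x) <= n%:R * (1 / 2 ^+ k).
  move=> k; have [p [idx [H1 H2 H3]]] := HN k.
  by exists (fun x => p (idx x)); split => //; exists (N k), p, idx.
exists (fun k x => g (s k x)); split.
  move=> k; have [[N' [p [idx [H1 H2 H3]]]] _] := Hs k.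
  exists N', (fun j => g (p j)), idx; split; first by move=> j; exact: Wg.
  by split => // x; rewrite H3.
apply: aeW => x; apply/cvgrPdist_le => e e0.
have [dl dl0 Hdl] := cg _ (Yi x) _ e0.
have /cvgrPdist_lt/(_ _ dl0) := geo_cvg0 (n%:R : R); apply: filterS => k.
rewrite sub0r normrN => kd; rewrite sub0r normrN ger0_norm ?Wnorm_ge0//.
have [[N' [p [idx [H1 H2 H3]]]] sx] := Hs k.
apply: Hdl; first by rewrite H3.
rewrite (le_lt_trans (sx x))// (le_lt_trans _ kd)// mul1r.
by rewrite (le_trans (ler_norm _)).
Qed.

End Measurability.

(** * Linearisation remainders and the choice of constants *)

Section ClosedLoopEstimates.
Variable R : realType.

Lemma sqr_WnormD n (y u z v : R -> 'cV[R]_n) : Wrep y u -> Wrep z v ->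
  Wnorm (fun t => y t + z t) ^+ 2 <= 2 * Wnorm y ^+ 2 + 2 * Wnorm z ^+ 2.
Proof.
move=> yu zv; have yzD := WrepD yu zv.
have L2D (a b : R -> 'cV[R]_n) : L2fun a -> L2fun b -> L2fun (fun t => a t + b t) ->
    L2sq (fun t => a t + b t) <= 2 * L2sq a + 2 * L2sq b.
  move=> La Lb Lab.
  have [t It|//] := L2fun_le La Lb (ler0n R 2) (ler0n R 2) Lab.1.
  exact: sqr_enormD.
have [Ly Lu _] := yu; have [Lz Lv _] := zv; have [Lyz Luv _] := yzD.
have add_le (a b c p q p1 q1 p2 q2 : R) : a = p + q -> b = p1 + q1 -> c = p2 + q2 ->
  p <= 2 * p1 + 2 * p2 -> q <= 2 * q1 + 2 * q2 -> a <= 2 * b + 2 * c by lra.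
exact: add_le (sqr_Wnorm yzD) (sqr_Wnorm yu) (sqr_Wnorm zv)
  (L2D _ _ Ly Lz Lyz) (L2D _ _ Lu Lv Luv).
Qed.

Lemma WnormN n (y u : R -> 'cV[R]_n) : Wrep y u -> Wnorm (fun t => - y t) = Wnorm y.
Proof.
move=> yu; have yuN : Wrep (fun t => - y t) (fun t => - u t).
  have := WrepB (Wrep0 R n) yu.
  by congr Wrep; apply/funext => t; rewrite sub0r.
have E (a : R -> 'cV[R]_n) : L2sq (fun t => - a t) = L2sq a.
  by congr fine; apply: eq_integral => t _; rewrite enormN.
have H : Wnorm (fun t => - y t) ^+ 2 = Wnorm y ^+ 2.
  by rewrite [LHS](sqr_Wnorm yuN) [RHS](sqr_Wnorm yu) !E.
have sqr_inj (a b : R) : 0 <= a -> 0 <= b -> a ^+ 2 = b ^+ 2 -> a = b.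
  by move=> a0 b0 ab; rewrite -(ger0_norm a0) -sqrtr_sqr ab sqrtr_sqr ger0_norm.
exact: sqr_inj (Wnorm_ge0 _) (Wnorm_ge0 _) H.
Qed.

Lemma cont_on_coord n m (K : set 'cV[R]_n) (F : 'cV[R]_n -> 'cV[R]_m) i :
  vcont_on K F -> cont_on K (fun x => F x i 0).
Proof.
move=> HF x Kx e e0; have [d d0 Hd] := HF x Kx e e0; exists d => // z Kz zx.
by rewrite (le_trans _ (Hd z Kz zx))// (le_trans _ (coord_le_enorm _ i))// !mxE.
Qed.

Lemma cont_on_lip n m p (K : set 'cV[R]_n) (A : 'cV[R]_n -> 'M[R]_(m, p)) (L : R) i j :
  0 <= L -> (forall x z, K x -> K z -> forall v,
    enorm ((A x - A z) *m v) <= L * enorm (x - z) * enorm v) ->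
  cont_on K (fun x => A x i j).
Proof.
move=> L0 HA x Kx e e0; have L1 : 0 < L + 1 by rewrite ltr_wpDl.
exists (e / (L + 1)); first by rewrite divr_gt0.
move=> z Kz; rewrite ltr_pdivlMr// => zx.
have := entry_le i j (HA z x Kz Kx); rewrite !mxE => h; rewrite (le_trans h)//.
have := enorm_ge0 (z - x); lra.
Qed.

(** At a point [p] of the segment, [D - DF x] splits into the approximation error at [p] and the
    variation of [DF] from [x] to [p]. It is used with error 0 for [f] and error [eps] for the
    network. *)
Lemma deriv_remainder n m r (F : 'cV[R]_n -> 'cV[R]_m) (DF : 'cV[R]_n -> 'M[R]_(m, n))
    (eps L : R) : 0 <= eps -> 0 <= L ->
  (forall p, cball0 r p -> exists2 D, hasDeriv F D p &
     forall v, enorm ((D - DF p) *m v) <= eps * enorm v) ->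
  (forall x z, cball0 r x -> cball0 r z -> forall v,
     enorm ((DF x - DF z) *m v) <= L * enorm (x - z) * enorm v) ->
  forall x a b, cball0 r x -> cball0 r a -> cball0 r b ->
    enorm (F a - F b - DF x *m (a - b)) <=
      (eps + L * (enorm (a - x) + enorm (b - x))) * enorm (a - b).
Proof.
move=> eps0 L0 HD HL x a b bx ba bb.
apply: (@mean_value_ineq _ _ _ setT) => //.
  by rewrite addr_ge0// mulr_ge0// addr_ge0// enorm_ge0.
move=> s s01; set p := b + s *: (a - b); have bp : cball0 r p := segment_cball0 s01 ba bb.
have [D DF' Dp] := HD p bp; exists D => // v.
have -> : D - DF x = (D - DF p) + (DF p - DF x) by rewrite addrA subrK.
rewrite mulmxDl (le_trans (enormD _ _))// mulrDl lerD ?Dp//.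
rewrite (le_trans (HL p x bp bx v))// ler_wpM2r ?enorm_ge0// ler_wpM2l//.
exact: segment_dist_le.
Qed.

(** One threshold for three purposes: the [16 * C] part bounds the deviation by [N / 4] and so keeps
    the trajectory in the ball, the rest makes the iteration contract. It depends on the uniform
    bound [Y], not on [N], hence serves all initial states. *)
Lemma smallness (C L Ci Y eta N : R) : 0 <= C -> 0 <= L -> 0 <= Ci -> 0 <= eta ->
  0 <= N -> N <= Y ->
  eta * (16 * C + 4 * C * (1 + 8 * (L * Ci * C * Y))) <= 1 ->
  [/\ 4 * C * eta * N <= N / 4,
      Ci * Y + Ci * (4 * C * eta * N) <= 2 * (Ci * Y) &
      4 * C * (eta + L * (2 * (Ci * (4 * C * eta * N)))) <= 1].
Proof.
move=> C0 L0 Ci0 eta0 N0 NY small.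
have LC : 0 <= L * Ci * C by rewrite !mulr_ge0.
have Y0 : 0 <= Y by exact: le_trans NY.
have eC : 0 <= eta * C by rewrite mulr_ge0.
have h1 : 16 * (eta * C) <= 1.
  apply: le_trans small; rewrite mulrDr -[leLHS]addr0.
  apply: lerD; first by rewrite mulrCA.
  by rewrite !mulr_ge0// addr_ge0// !mulr_ge0.
have h2 : 4 * C * eta * N <= N / 4.
  have -> : 4 * C * eta * N = 16 * (eta * C) * (N / 4) by field.
  by rewrite ler_piMl// divr_ge0.
split => //.
  have h3 : 4 * C * eta * N <= Y.
    by rewrite (le_trans h2)// (le_trans _ NY)// ler_pdivrMr// ler_peMr// ler1n.
  by have := ler_wpM2l Ci0 h3; lra.
apply: le_trans small.
have -> : 4 * C * (eta + L * (2 * (Ci * (4 * C * eta * N)))) =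
  eta * (4 * C * (1 + 8 * (L * Ci * C * N))) by ring.
rewrite ler_wpM2l// -[leLHS]add0r lerD ?mulr_ge0// ler_wpM2l ?mulr_ge0//.
by rewrite lerD2l ler_pM2l// ler_wpM2l.
Qed.

(* Replaces Minkowski's inequality in the bound 3/2 M|y0|: 2 (1 + 1/16) <= (3/2)^2. *)
Lemma sqr_three_half (a b s N : R) : 0 <= N -> 0 <= a -> a <= N -> 0 <= b -> b <= N / 4 ->
  0 <= s -> s ^+ 2 <= 2 * a ^+ 2 + 2 * b ^+ 2 -> s <= 3 / 2 * N.
Proof.
move=> N0 a0 aN b0 bN s0 h; rewrite -(ler_pXn2r (n:=2))// ?nnegrE ?mulr_ge0//.
have a2 : a ^+ 2 <= N ^+ 2 by rewrite lerXn2r ?nnegrE.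
have b2 : b ^+ 2 <= (N / 4) ^+ 2 by rewrite lerXn2r ?nnegrE// divr_ge0.
rewrite !exprMn in b2 *.
have N2 : 0 <= N ^+ 2 by exact: sqr_ge0.
rewrite (le_trans h)//; move: a2 b2 N2; set x := N ^+ 2; rewrite !exprVn !expr2; lra.
Qed.

End ClosedLoopEstimates.

(** * The closed loop driven by an approximating network *)

Theorem mainTheorem12
  (R : realType) (n m : nat)
  (f : 'cV[R]_n -> 'cV[R]_n) (Df : 'cV[R]_n -> 'M[R]_n)
  (B : 'M[R]_(n, m)) (Q : 'M[R]_n) (beta : R)
  (Ci : R) (Y0 Nb : set 'cV[R]_n)
  (Fs : 'cV[R]_n -> 'cV[R]_m) (DFs : 'cV[R]_n -> 'M[R]_(m, n))
  (ystar : 'cV[R]_n -> R -> 'cV[R]_n) (M C : R)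
  (d : measure_display) (T : measurableType d) (P : probability T R)
  (iota : T -> 'cV[R]_n)
  (sigma : R -> R) (theta : R -> net R n m)
  (* problem data *)
  (HQ : psd Q) (Hbeta : 0 < beta)
  (* the embedding constant C_i *)
  (HCi : 0 < Ci)
  (HCemb : forall y : R -> 'cV[R]_n, Winf y -> forall t, Itime R t -> enorm (y t) <= Ci * Wnorm y)
  (* Standing Assumption 1 *)
  (HY0c : compact Y0) (HY00 : Y0 0)
  (HA1 : assumptionA1 f Df)
  (HNopen : open Nb) (HY0N : Y0 `<=` Nb) (HFs0 : Fs 0 = 0)
  (HA2 : forall y0, Nb y0 ->
     closedLoop f B Fs y0 (ystar y0) /\
     (forall y, closedLoop f B Fs y0 y -> eqI y (ystar y0)) /\
     minimizesP f B Q beta y0 (ystar y0) (fun t => Fs (ystar y0 t)))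
  (HA3diff : C1FrechetW Nb ystar)
  (HM : 0 < M)
  (HA3bound : forall y0, Nb y0 -> Wnorm (ystar y0) <= M * enorm y0)
  (HA4C1 : forall x, cball0 (2%:R * (Ci * MY0 M Y0)) x ->
     hasDerivWithin (cball0 (2%:R * (Ci * MY0 M Y0))) Fs (DFs x) x)
  (HA4Lip : exists L : R, forall x z,
     cball0 (2%:R * (Ci * MY0 M Y0)) x -> cball0 (2%:R * (Ci * MY0 M Y0)) z ->
     opnorm (DFs x - DFs z) <= L * enorm (x - z))
  (* Assumption 3 *)
  (HC : 0 < C)
  (HAs3 : forall y0, Nb y0 -> forall (dy0 : 'cV[R]_n) (dv : R -> 'cV[R]_n),
     L2fun dv ->
     exists2 dy : R -> 'cV[R]_n,
       solvesW (fun t x => Df (ystar y0 t) *m x + B *m (DFs (ystar y0 t) *m x) + dv t)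
               dy0 dy &
       Wnorm dy <= C * (L2norm dv + enorm dy0) /\
       (forall z, solvesW
               (fun t x => Df (ystar y0 t) *m x + B *m (DFs (ystar y0 t) *m x) + dv t)
               dy0 z -> eqI z dy))
  (* (Y0, A, mu): complete probability space, Borel sets measurable *)
  (Hcompl : measure_is_complete P)
  (Hiota_inj : injective iota) (Hiota_rng : range iota = Y0)
  (Hborel : forall O : set 'cV[R]_n, open O -> measurable (iota @^-1` O))
  (* sigma in C^1(R) *)
  (Hsigma : (forall x, derivable sigma x 1) /\ continuous (derive1 sigma))
  (* theta_eps is eps-approximating *)
  (Htheta : forall eps : R, 0 < eps ->
     eps_approximating sigma Fs DFs (2%:R * (Ci * MY0 M Y0)) (theta eps) eps) :
  exists2 eps1 : R, 0 < eps1 & exists2 c : R, 0 < c &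
  forall eps : R, 0 < eps -> eps < eps1 ->
  exists yeps : 'cV[R]_n -> R -> 'cV[R]_n,
    (forall y0, Y0 y0 ->
       [/\ Yad M Y0 (yeps y0),
           closedLoop f B (netF sigma (theta eps)) y0 (yeps y0),
           (forall z, Yad M Y0 z -> closedLoop f B (netF sigma (theta eps)) y0 z ->
              eqI z (yeps y0)),
           Wnorm (fun t => ystar y0 t - yeps y0 t) <= c * eps &
           Wnorm (yeps y0) <= (3%:R / 2%:R) * M * enorm y0]) /\
    LinfW P (fun x => yeps (iota x)) /\
    (LinfW_norm P (fun x => yeps (iota x)) <= ((3%:R / 2%:R) * MY0 M Y0)%:E)%E.
Proof.
set Y := MY0 M Y0 in HA4C1 HA4Lip Htheta *.
set r := 2%:R * (Ci * Y) in HA4C1 HA4Lip Htheta *.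
have I0 : Itime R 0 by apply/Itime_ge0.
have YM y0 : Y0 y0 -> M * enorm y0 <= Y.
  move=> Yy0; rewrite ler_pM2l//; apply: ub_le_sup; last by exists y0.
  exact: compact_enorm_bounded.
have Y_ge0 : 0 <= Y by have := YM _ HY00; rewrite enorm0 mulr0.
have r0 : 0 <= r by exact: mulr_ge0 (ler0n _ 2) (mulr_ge0 (ltW HCi) Y_ge0).
have ball0 : cball0 r (0 : 'cV[R]_n) by rewrite /cball0/= enorm0.
have opnorm_lip p q (H : 'cV[R]_n -> 'M[R]_(p, q)) (S : set 'cV[R]_n) (l : R) :
    (forall x z, S x -> S z -> opnorm (H x - H z) <= l * enorm (x - z)) ->
    forall x z, S x -> S z -> forall v,
      enorm ((H x - H z) *m v) <= `|l| * enorm (x - z) * enorm v.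
  move=> HS x z Sx Sz v; apply: enorm_mulmx_le; rewrite (le_trans (HS x z Sx Sz))//.
  by rewrite ler_wpM2r ?enorm_ge0// ler_norm.
have [fD [_ [f0 fLip]]] := HA1.
have [Lf Lf0 HLf] : exists2 Lf : R, 0 <= Lf & forall x z, cball0 r x -> cball0 r z ->
    forall v, enorm ((Df x - Df z) *m v) <= Lf * enorm (x - z) * enorm v.
  have [K cK bK] := @cball0_subset_compact R n r.
  have [l Hl] := fLip K cK; exists `|l| => // x z bx bz.
  exact: opnorm_lip Hl x z (bK _ bx) (bK _ bz).
have [Ls Ls0 HLs] : exists2 Ls : R, 0 <= Ls & forall x z, cball0 r x -> cball0 r z ->
    forall v, enorm ((DFs x - DFs z) *m v) <= Ls * enorm (x - z) * enorm v.
  by have [l Hl] := HA4Lip; exists `|l| => //; exact: opnorm_lip Hl.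
pose KB := frob B; have KB0 : 0 <= KB by exact: frob_ge0.
pose g0 x := f x + B *m Fs x.
pose A x := Df x + B *m DFs x.
pose L := Lf + KB * Ls; have L0 : 0 <= L := addr_ge0 Lf0 (mulr_ge0 KB0 Ls0).
have ALip x z : cball0 r x -> cball0 r z -> forall v,
    enorm ((A x - A z) *m v) <= L * enorm (x - z) * enorm v.
  move=> bx bz v.
  have -> : (A x - A z) *m v = (Df x - Df z) *m v + B *m ((DFs x - DFs z) *m v).
    by rewrite /A opprD addrACA -mulmxBr mulmxDl mulmxA.
  rewrite (le_trans (enormD _ _))//.
  have h1 := HLf x z bx bz v; have h2 := HLs x z bx bz v.
  have h3 := enorm_mulmx_frob B ((DFs x - DFs z) *m v).
  have h4 := ler_wpM2l KB0 h2.
  by rewrite /L !mulrDl (le_trans (lerD h1 (le_trans h3 h4)))// !mulrA.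
(* A bound for [A] on the ball: its size at the centre plus its Lipschitz variation. *)
pose Kc := frob (A 0) + L * r.
have Kc0 : 0 <= Kc := addr_ge0 (frob_ge0 _) (mulr_ge0 L0 r0).
have Abd x v : cball0 r x -> enorm (A x *m v) <= Kc * enorm v.
  move=> bx; have -> : A x *m v = A 0 *m v + (A x - A 0) *m v.
    by rewrite mulmxBl subrKC.
  rewrite (le_trans (enormD _ _))// mulrDl lerD ?enorm_mulmx_frob//.
  rewrite (le_trans (ALip _ _ bx ball0 v))// subr0 ler_wpM2r ?enorm_ge0//.
  by rewrite ler_wpM2l.
have cA i j : cont_on (cball0 r) (fun x => A x i j) := cont_on_lip i j L0 ALip.
have cf : vcont_on (cball0 r) f.
  apply: hasDerivWithin_vcont => x _; exists (Df x).
  exact: hasDerivWithinS (@subsetT _ _) (fD x).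
have cFs : vcont_on (cball0 r) Fs.
  by apply: hasDerivWithin_vcont => x bx; exists (DFs x); exact: HA4C1.
have cg0 i : cont_on (cball0 r) (fun x => g0 x i 0).
  exact/cont_on_coord/vcont_onD_mulmx.
have Wys y0 : Nb y0 -> Winf (ystar y0) by move=> /HA2[[]].
have ysY y0 t : Y0 y0 -> Itime R t -> enorm (ystar y0 t) <= Ci * Y.
  move=> Yy0 It; have Ny0 := HY0N _ Yy0.
  rewrite (le_trans (HCemb _ (Wys _ Ny0) t It))// ler_pM2l//.
  by rewrite (le_trans (HA3bound _ Ny0))// YM.
have CiYr : Ci * Y <= r.
  by rewrite /r ler_peMl ?ler1n//; exact: mulr_ge0 (ltW HCi) Y_ge0.
have ysb y0 : Y0 y0 -> in_ball r (ystar y0).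
  by move=> Yy0 t It; exact: le_trans (ysY _ _ Yy0 It) CiYr.
have ysW y0 : Y0 y0 -> Wrep (ystar y0) (fun t => g0 (ystar y0 t)) /\ ystar y0 0 = y0.
  move=> Yy0; have Ny0 := HY0N _ Yy0; have /Winf_Wrep[u yu] := Wys _ Ny0.
  have [cl _] := HA2 _ Ny0; apply: (solvesW_Wrep cl) => i.
  exact: (measurable_cont_on yu (ysb _ Yy0) (cg0 i)).
have lys y0 : Y0 y0 -> lin_solvable A C (ystar y0).
  move=> Yy0 dy0 dv Ldv; have := HAs3 _ (HY0N _ Yy0) dy0 dv Ldv.
  suff -> : (fun t x => Df (ystar y0 t) *m x + B *m (DFs (ystar y0 t) *m x) + dv t) =
      (fun t x => A (ystar y0 t) *m x + dv t) by [].
  by apply/funext => t; apply/funext => x; rewrite /A mulmxDl mulmxA.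
have C0 : 0 <= C by exact: ltW.
pose Qs := 16 * C + 4 * C * (1 + 8 * (L * Ci * C * Y)).
have Qs0 : 0 < Qs.
  have LCY : 0 <= L * Ci * C * Y.
    exact: mulr_ge0 (mulr_ge0 (mulr_ge0 L0 (ltW HCi)) C0) Y_ge0.
  rewrite ltr_pwDl ?mulr_gt0//; apply: mulr_ge0; first exact: mulr_ge0.
  by rewrite addr_ge0// mulr_ge0.
have KB1 : 0 < KB + 1 by rewrite ltr_wpDl.
(* The summand [1] here and in [c] keeps both constants positive when [B = 0]. *)
exists ((KB + 1) * Qs)^-1; first by rewrite invr_gt0 mulr_gt0.
pose c := 4 * C * KB * Y + 1.
have CKY : 0 <= 4 * C * KB * Y.
  exact: mulr_ge0 (mulr_ge0 (mulr_ge0 (ler0n _ 4) C0) KB0) Y_ge0.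
exists c; first by rewrite ltr_wpDl.
move=> eps eps0 epslt; have eps0' := ltW eps0.
pose eta := KB * eps; have eta0 : 0 <= eta := mulr_ge0 KB0 eps0'.
have small : eta * Qs <= 1.
  have h : eps * ((KB + 1) * Qs) < 1 by rewrite -ltr_pdivlMr ?mulr_gt0// mul1r.
  rewrite (le_trans _ (ltW h))// mulrA ler_wpM2r ?(ltW Qs0)// /eta mulrC.
  by rewrite ler_wpM2l// lerDl.
pose G := netF sigma (theta eps).
pose g1 x := f x + B *m G x.
have GD p : cball0 r p -> exists2 D, hasDeriv G D p &
    forall v, enorm ((D - DFs p) *m v) <= eps * enorm v.
  move=> bp; have [D GDp Dle] := Htheta eps eps0 p bp; exists D => // v.
  rewrite -enormN -mulNmx opprB; apply: enorm_mulmx_le.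
  by rewrite (le_trans _ Dle)// lerDr enorm_ge0.
(* [f] counts as an approximation of itself with error 0, so that [deriv_remainder] covers it
   too. *)
have fD0 p : cball0 r p -> exists2 D, hasDeriv f D p &
    forall v, enorm ((D - Df p) *m v) <= 0 * enorm v.
  by move=> _; exists (Df p) => // v; rewrite subrr mul0mx enorm0 mul0r.
have Frem := deriv_remainder (lexx 0) Lf0 fD0 HLf.
have Grem := deriv_remainder eps0' Ls0 GD HLs.
have lin1 x a b : cball0 r x -> cball0 r a -> cball0 r b ->
    enorm (g1 a - g1 b - A x *m (a - b)) <=
      (eta + L * (enorm (a - x) + enorm (b - x))) * enorm (a - b).
  move=> bx ba bb.
  have -> : g1 a - g1 b - A x *m (a - b) = (f a - f b - Df x *m (a - b)) +
      B *m (G a - G b - DFs x *m (a - b)).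
    rewrite /g1 /A mulmxDl !mulmxBr -!mulmxA.
    move: (_ *m _) (_ *m _) (_ *m _) (_ *m _) (_ *m _) (_ *m _) => u1 u2 u3 u4 u5 u6.
    by apply/matrixP => i j; rewrite !mxE; ring.
  rewrite (le_trans (enormD _ _))//.
  have h1 := Frem x a b bx ba bb; have h2 := ler_wpM2l KB0 (Grem x a b bx ba bb).
  have h3 := enorm_mulmx_frob B (G a - G b - DFs x *m (a - b)).
  rewrite (le_trans (lerD h1 (le_trans h3 h2)))// /eta /L.
  by rewrite le_eqVlt; apply/orP; left; apply/eqP; ring.
have g10 x : cball0 r x -> enorm (g1 x - g0 x) <= eta * enorm x.
  have addB (u : 'cV[R]_n) (v z : 'cV[R]_m) : u + B *m v - (u + B *m z) = B *m (v - z).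
    by rewrite opprD addrACA subrr add0r mulmxBr.
  move=> bx; have -> : g1 x - g0 x = B *m (G x - Fs x) by exact: addB.
  rewrite (le_trans (enorm_mulmx_frob _ _))// -mulrA ler_wpM2l//.
  (* Between [x] and 0, with comparison matrix 0: [G - Fs] vanishes at 0 and its derivative is at
     most [eps]. *)
  have := @mean_value_ineq R n m (cball0 r) (fun z => G z - Fs z) 0 x 0 eps eps0'.
  rewrite !subr0 mul0mx subr0 HFs0 subr0 [G 0]subrr subr0; apply.
    by move=> s s01; rewrite -[x in s *: x]subr0; exact: segment_cball0.
  move=> s s01; set p := 0 + s *: x.
  have bp : cball0 r p by rewrite /p -[x in s *: x]subr0; exact: segment_cball0.
  have [D GDp Dle] := GD p bp; exists (D - DFs p); last by move=> v; rewrite subr0.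
  apply: hasDerivWithinB; last exact: HA4C1.
  exact: hasDerivWithinS (@subsetT _ _) GDp.
have cG : vcont_on (cball0 r) G.
  apply: hasDerivWithin_vcont => x bx; have [D GDx _] := GD x bx; exists D.
  exact: hasDerivWithinS (@subsetT _ _) GDx.
have cg1 i : cont_on (cball0 r) (fun x => g1 x i 0).
  exact/cont_on_coord/vcont_onD_mulmx.
pose rho := 4 * C * eta * Y.
have /choice[w Hw] : forall y0, exists w, Y0 y0 ->
    [/\ Wrep w (fun t => g1 (ystar y0 t + w t) - g0 (ystar y0 t)), w 0 = 0
      & Wnorm w <= 4 * C * eta * (M * enorm y0)].
  move=> y0; have [Yy0|] := pselect (Y0 y0); last by exists (fun=> 0).
  have N0 : 0 <= M * enorm y0 by rewrite mulr_ge0 ?enorm_ge0// ltW.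
  have [_ s2 s3] := smallness C0 L0 (ltW HCi) eta0 N0 (YM _ Yy0) small.
  have [yW _] := ysW _ Yy0.
  have [|w Hw] := perturbed_solution HCi HC L0 Kc0 eta0 HCemb cg0 cg1 cA lin1 g10 Abd
    yW (lys _ Yy0) (HA3bound _ (HY0N _ Yy0)) _ s3; last by exists w.
  by move=> t It; rewrite (le_trans _ s2)// lerD2r ysY.
pose yeps y0 t := ystar y0 t + w y0 t.
have wrho y0 : Y0 y0 -> Wnorm (w y0) <= rho.
  move=> Yy0; have [_ _ h] := Hw _ Yy0; rewrite (le_trans h)//.
  by rewrite ler_wpM2l ?YM//; exact: mulr_ge0 (mulr_ge0 (ler0n _ 4) C0) eta0.
have yW y0 : Y0 y0 -> Wrep (yeps y0) (fun t => g1 (yeps y0 t)).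
  move=> Yy0; have [wW _ _] := Hw _ Yy0; have [yW _] := ysW _ Yy0.
  by have := WrepD yW wW; congr Wrep; apply/funext => t; rewrite subrKC.
have y00 y0 : Y0 y0 -> yeps y0 0 = y0.
  by move=> Yy0; have [_ w0 _] := Hw _ Yy0; rewrite /yeps w0 addr0 (ysW _ Yy0).2.
have ynorm y0 : Y0 y0 -> Wnorm (yeps y0) <= (3 / 2) * M * enorm y0.
  move=> Yy0; have [wW _ wle] := Hw _ Yy0; have [yW' _] := ysW _ Yy0.
  have N0 : 0 <= M * enorm y0 by rewrite mulr_ge0 ?enorm_ge0// ltW.
  have [s1 _ _] := smallness C0 L0 (ltW HCi) eta0 N0 (YM _ Yy0) small.
  rewrite -mulrA; apply: (sqr_three_half N0 (Wnorm_ge0 (ystar y0)) _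
    (Wnorm_ge0 (w y0)) (le_trans wle s1) (Wnorm_ge0 _) (sqr_WnormD yW' wW)).
  exact: HA3bound (HY0N _ Yy0).
have ynormY y0 : Y0 y0 -> Wnorm (yeps y0) <= (3 / 2) * Y.
  by move=> Yy0; rewrite (le_trans (ynorm _ Yy0))// -mulrA ler_pM2l ?YM.
have yad y0 : Y0 y0 -> Yad M Y0 (yeps y0).
  move=> Yy0; split; first exact: Wrep_Winf (yW _ Yy0).
  by rewrite (le_trans (ynormY _ Yy0))// ler_wpM2r// ler_pdivrMr// -natrM ler_nat.
(* Here the radius fits exactly: the embedding turns the bound [2 * Y] of [Yad] into [r], so
   uniqueness covers every competitor in [Yad]. *)
have yadb z : Yad M Y0 z -> in_ball r z.
  move=> [Wz zY] t It; rewrite /cball0/= (le_trans (HCemb _ Wz t It))//.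
  by rewrite /r mulrCA ler_pM2l.
have wt y0 t : Y0 y0 -> Itime R t -> enorm (yeps y0 t - ystar y0 t) <= Ci * rho.
  move=> Yy0 It; rewrite /yeps addrC addKr; have [wW _ _] := Hw _ Yy0.
  rewrite (le_trans (HCemb _ (Wrep_Winf wW) t It))// ler_pM2l//.
  exact: wrho.
have rho0 : 0 <= rho.
  exact: mulr_ge0 (mulr_ge0 (mulr_ge0 (ler0n _ 4) C0) eta0) Y_ge0.
exists yeps; split; [|split].
- move=> y0 Yy0; split.
  + exact: yad.
  + by apply: Wrep_solvesW (yW _ Yy0) _ (y00 _ Yy0).
  + move=> z yadz clz; have [/Winf_Wrep[u zu] _] := clz.
    have [|zW z0] := solvesW_Wrep clz.
      by move=> i; exact: (measurable_cont_on zu (yadb _ yadz) (cg1 i)).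
    apply: (closed_loop_unique L0 Kc0 eta0 lin1 Abd zW (yW _ Yy0)).
    * exact: yadb.
    * exact/yadb/yad.
    * by rewrite z0 y00.
  + have [wW _ _] := Hw _ Yy0.
    rewrite (_ : (fun t => _) = (fun t => - w y0 t)); last first.
      by apply/funext => t; rewrite /yeps opprD addNKr.
    rewrite (WnormN wW) (le_trans (wrho _ Yy0))// /rho /eta /c.
    have -> : 4 * C * (KB * eps) * Y = 4 * C * KB * Y * eps by ring.
    by rewrite ler_wpM2r// lerDl.
  + exact: ynorm.
- have Yi x : Y0 (iota x) by rewrite -Hiota_rng; exists x.
  have bound x : ((Wnorm (yeps (iota x)))%:E <= ((3 / 2) * Y)%:E)%E.
    by rewrite lee_fin ynormY.
  split; last split.
  + apply: (strongly_measurableW_continuous Hborel _ HY0c HY00 Yi).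
      by move=> y Yy; exact: Wrep_Winf (yW _ Yy).
    move=> y Yy e e0.
    have CL1 : 0 < 4 * (C * L + 1) by rewrite mulr_gt0// ltr_wpDl// mulr_ge0.
    (* [dl] makes [2 * C * L * dl] at most one half; the other half of the smallness required by
       [solution_dist] comes from [smallness]. *)
    pose dl := (4 * (C * L + 1))^-1; have dl0 : 0 < dl by rewrite invr_gt0.
    have [d1 d10 Hd1] := C1FrechetW_continuous HCi HCemb HA3diff Wys (HY0N _ Yy) dl0.
    exists (Num.min d1 (e / (2 * C))); first by rewrite lt_min d10 divr_gt0// mulr_gt0.
    move=> z Yz; rewrite lt_min ltr_pdivlMr ?mulr_gt0// => /andP[zd ze].
    (* Both solutions are compared along the optimal trajectory from [y]: the one from [y] stays
       within [Ci * rho] of it, the one from [z] within [Ci * rho + dl]. *)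
    have := @solution_dist _ _ _ _ _ _ _ _ HC L0 eta0 cA lin1 _ _ _ _
      (2 * (Ci * rho) + dl) (lys _ Yy) (ysW _ Yy).1 (ysb _ Yy) (yW _ Yz) (yW _ Yy)
      (yadb _ (yad _ Yz)) (yadb _ (yad _ Yy)).
    rewrite !y00// => H; rewrite (le_trans (H _ _ _))//.
    * move=> t It; have h1 := wt _ t Yz It; have h2 := wt _ t Yy It.
      have h3 := Hd1 z (HY0N _ Yz) zd t It.
      rewrite -[yeps z t - ystar y t](subrKA (ystar z t)).
      have h4 := enormD (yeps z t - ystar z t) (ystar z t - ystar y t).
      lra.
    * by apply: addr_ge0 (ltW dl0); exact: mulr_ge0 (ler0n _ 2) (mulr_ge0 (ltW HCi) rho0).
    * have [_ _ s3] := smallness C0 L0 (ltW HCi) eta0 Y_ge0 (lexx Y) small.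
      have h : 4 * (C * L * dl) <= 1.
        by rewrite /dl mulrA ler_pdivrMr// mul1r ler_pM2l// lerDl.
      move: s3; rewrite -/rho mulrDr mulrA; lra.
    * by rewrite mulrC ltW.
  + by apply: aeW => x; exact: Wrep_Winf (yW _ (Yi x)).
  + apply: (@le_lt_trans _ _ ((3 / 2) * Y)%:E); last exact: ltry.
    by apply/ess_supP; apply: aeW => x; exact: bound.
- have Yi x : Y0 (iota x) by rewrite -Hiota_rng; exists x.
  by apply/ess_supP; apply: aeW => x; rewrite lee_fin ynormY.
Qed.
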